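(* Let $t\ge 2$ be an integer. There exists a positive real $c_3=c_3(t)$ such that the following holds. If $G$ is a $4$-graph not containing $L^4_t$ as a subgraph, then $\lambda(G)\le \lambda(K^4_{3t})=\frac{(3t-1)(3t-2)(3t-3)}{24(3t)^3}$. Furthermore, if $G$ also covers pairs and $G\ne K^4_{3t}$, then $\lambda(G)\le \lambda(K^4_{3t})-c_3$.
   Context: An $r$-graph is a vertex set with a family of $r$-element subsets (edges). $K^r_p$ is the complete $r$-graph on $p$ vertices. The linear star $L^r_t$ is the $r$-graph with $t$ edges all containing a common vertex $x$ and pairwise disjoint outside $\{x\}$. An $r$-graph covers pairs if every pair of its vertices is contained in some edge. For an $r$-graph $G$ on $[n]$ and $\vec x\in[0,\infty)^n$, $\lambda(G,\vec x)=\sum_{e\in E(G)}\prod_{i\in e}x_i$, and $\lambda(G)=\max\{\lambda(G,\vec x):\vec x\ge0,\ \sum_ix_i=1\}$. *)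

(* Defs.v *)
From HB Require Import structures.
From mathcomp Require Import all_boot all_order all_algebra.
From mathcomp Require Import all_classical all_reals all_analysis.

Set Implicit Arguments.
Unset Strict Implicit.
Unset Printing Implicit Defensive.

Import Order.TTheory GRing.Theory Num.Theory.
Import numFieldNormedType.Exports.

Local Open Scope classical_set_scope.
Local Open Scope ring_scope.

Record ugraph (r : nat) (V : finType) := UGraph {
  edges : {set {set V}};
  edge_card : forall e, e \in edges -> #|e| = r
}.

Definition complete_edges (r p : nat) : {set {set 'I_p}} :=
  [set e : {set 'I_p} | #|e| == r]%SET.

Lemma complete_uniform (r p : nat) (e : {set 'I_p}) :
  e \in complete_edges r p -> #|e| = r.
Proof. by rewrite inE => /eqP. Qed.

Definition complete_ugraph (r p : nat) : ugraph r 'I_p :=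
  UGraph (@complete_uniform r p).

(* The centre of the star is [None]; [Some (i, j)] is the j-th of the s
   non-central vertices of the i-th edge, so the edges have s.+1 elements. *)
Definition star_edge (s t : nat) (i : 'I_t) : {set option ('I_t * 'I_s)} :=
  (None |: [set Some (i, j) | j : 'I_s])%SET.

Definition linear_star_edges (s t : nat) : {set {set option ('I_t * 'I_s)}} :=
  [set star_edge s i | i : 'I_t]%SET.

Lemma linear_star_uniform (s t : nat) (e : {set option ('I_t * 'I_s)}) :
  e \in linear_star_edges s t -> #|e| = s.+1.
Proof.
case/imsetP=> i _ ->; rewrite /star_edge cardsU1 card_imset ?card_ord.
  by case: imsetP => // -[].
by move=> j k [].
Qed.

(* [linear_star s t] is L^r_t for r = s.+1. *)
Definition linear_star (s t : nat) : ugraph s.+1 (option ('I_t * 'I_s)) :=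
  UGraph (@linear_star_uniform s t).

(* G has a (not necessarily induced) subgraph isomorphic to H. *)
Definition contains (r : nat) (V W : finType) (G : ugraph r V) (H : ugraph r W) :=
  exists2 f : W -> V, injective f
    & forall e : {set W}, e \in edges H -> (f @: e)%SET \in edges G.

Definition isomorphic (r : nat) (V W : finType) (G : ugraph r V) (H : ugraph r W) :=
  exists2 f : V -> W, bijective f
    & forall e : {set V}, ((f @: e)%SET \in edges H) = (e \in edges G).

Definition covers_pairs (r : nat) (V : finType) (G : ugraph r V) :=
  forall u v : V, u != v -> exists2 e, e \in edges G & (u \in e) && (v \in e).

Definition lagrange_poly (R : realType) (r : nat) (V : finType)
    (G : ugraph r V) (x : V -> R) : R :=
  \sum_(e in edges G) \prod_(i in e) x i.

Definition simplex (R : realType) (V : finType) : set (V -> R) :=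
  [set x | (forall i, 0 <= x i) /\ \sum_i x i = 1].
Arguments simplex R V : clear implicits.

(* By [lagrangian_attained] and [lagrangian_ge] below, this supremum is a
   maximum as soon as V is nonempty; it is 0 when V is empty. *)
Definition lagrangian (R : realType) (r : nat) (V : finType)
    (G : ugraph r V) : R :=
  sup [set lagrange_poly G x | x in simplex R V].

Lemma simplex_le1 (R : realType) (V : finType) (x : V -> R) :
  simplex R V x -> forall i, x i <= 1.
Proof.
move=> [x0 <-] i; rewrite (bigD1 i) //= lerDl.
by apply: sumr_ge0.
Qed.

Lemma lagrange_poly_le (R : realType) (r : nat) (V : finType)
    (G : ugraph r V) (x : V -> R) :
  simplex R V x -> lagrange_poly G x <= #|edges G|%:R.
Proof.
move=> xS; rewrite /lagrange_poly -sum1_card natr_sum.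
apply: ler_sum => e _; apply: prodr_ile1 => i _.
by rewrite (simplex_le1 xS) andbT; case: xS.
Qed.

Lemma lagrangian_ge (R : realType) (r : nat) (V : finType)
    (G : ugraph r V) (x : V -> R) :
  simplex R V x -> lagrange_poly G x <= lagrangian R G.
Proof.
move=> xS; apply: ub_le_sup; last by exists x.
by exists #|edges G|%:R => _ [y yS <-]; exact: lagrange_poly_le.
Qed.

Lemma continuous_coord (R : realType) (V : finType) (i : V) :
  continuous (fun x : prod_topology (fun _ : V => R) => x i).
Proof. exact: (@proj_continuous V (fun _ => R) i). Qed.

Lemma compact_simplex (R : realType) (V : finType) :
  @compact (prod_topology (fun _ : V => R)) (simplex R V).
Proof.
pose A (i : V) : set R := `[0, 1]%classic.
have cA := @tychonoff V (fun=> R) A (fun i => @segment_compact R 0 1).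
have -> : simplex R V = [set f : prod_topology (fun _ : V => R) | forall i, A i (f i)]
    `&` (fun x : prod_topology (fun _ : V => R) => \sum_i x i) @^-1` [set 1].
  apply/seteqP; split => x /=.
    move=> xS; split; last by case: xS.
    by move=> i; rewrite /A /= in_itv /= (simplex_le1 xS) andbT; case: xS.
  by move=> [xA x1]; split=> // i; have := xA i; rewrite /A /= in_itv /= => /andP[].
apply: compact_closedI => //.
apply: preimage_closed; last exact: closed_eq.
move=> x _; move: x.
apply: (@continuous_big R V +%R 0 xpredT _ (prod_topology (fun _ : V => R)) _ (fun i x => x i)).
  exact: add_continuous.
by move=> i _; exact: continuous_coord.
Qed.

Lemma lagrangian_attained (R : realType) (r : nat) (V : finType)
    (G : ugraph r V) : (0 < #|V|)%N ->
  exists2 x, simplex R V x & lagrangian R G = lagrange_poly G x.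
Proof.
move=> /card_gt0P[v0 _].
have S0 : simplex R V !=set0.
  exists (fun v => (v == v0)%:R); split=> [i|]; first exact: ler0n.
  by rewrite (bigD1 v0) //= eqxx big1 ?addr0 // => i /negPf ->.
have [|c cS cmax] := @compact_EVT_max (prod_topology (fun _ : V => R)) R
  (@lagrange_poly R r V G) _ S0 (@compact_simplex R V).
  apply: continuous_subspaceT.
  apply: (@continuous_big R {set V} +%R 0 (mem (edges G)) _ (prod_topology (fun _ : V => R)) _
    (fun e x => \prod_(i in e) x i)).
    exact: add_continuous.
  move=> e _; apply: (@continuous_big R V *%R 1 (mem e) _ (prod_topology (fun _ : V => R)) _
    (fun i x => x i)).
    exact: mul_continuous.
  by move=> i _; exact: continuous_coord.
exists c; first by move: cS; rewrite inE.
apply/eqP; rewrite eq_le lagrangian_ge ?andbT; last by move: cS; rewrite inE.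
apply: ge_sup => [|_ [x xS <-]]; first by case: S0 => y ?; exists (lagrange_poly G y), y.
by apply: cmax; rewrite inE.
Qed.

(* Main.v *)
Require Import Defs.
From mathcomp Require Import all_boot all_order all_algebra.
From mathcomp Require Import all_classical all_reals all_analysis.
(* Imported again so that the names shared with classical_sets denote finite sets. *)
From mathcomp Require Import fintype finset perm zify ring lra.

(* Let x be an optimal weighting of G and v a vertex of maximal weight. The
   first-order conditions give 4 * lambda(G) <= lambda(L_v, x), where the link
   L_v is a 3-graph without t disjoint edges. Order the other vertices by
   decreasing weight and left-compress L_v. A compressed family without t
   disjoint triples contains no triple whose ranks (from 0) are at least t-1,
   2t-1 and 3t-1. Cutting the ranks at these three values into blocks and
   applying Maclaurin's inequality inside each block bounds lambda(L_v, x) by an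
   explicit cubic form in the averages a >= b, c of the first three blocks and
   the weight z of the remaining vertices, and this form is at most
   4 * lambda(K_{3t}) (t(a + b + c) + z)^3, where t(a + b + c) + z <= 1 because
   a <= x_v. The inequality is stable: near equality forces the 3t heaviest
   vertices to carry almost all the weight, in almost equal parts. If one of
   their 4-subsets is not an edge, lambda(G) drops by a fixed amount; otherwise
   they span a clique, and an edge covering a pair that leaves the clique would
   complete a linear star, so covering pairs forces G = K_{3t}. *)

Set Implicit Arguments.
Unset Strict Implicit.
Unset Printing Implicit Defensive.

Import Order.TTheory GRing.Theory Num.Theory.

Local Open Scope ring_scope.

(** * The cubic form inequality *)

Section FormInequality.
Variable R : realFieldType.
Implicit Types p q z t : R.

(** This is the coefficient of t - 2 in the expansion behind [star_link_form_le]: p and q stand for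
    the relative deficits 1 - b/a and 1 - c/a, and z for z/(ta). *)
Lemma form_coef1_ge0 p q z : 0 <= p <= 1 -> 0 <= q <= 1 -> 0 <= z ->
  0 <= 3 * (p + q) - 6 * p * q - (p + q) ^+ 3 / 3 + 2 * p * q * (p + q)
       + z * (5 - 10 * (p + q) + 3 * (p + q) ^+ 2 + 8 * p - 4 * p ^+ 2)
       + z ^+ 2 * (5 - 3 * (p + q)) + z ^+ 3.
Proof.
move=> /andP[p0 p1] /andP[q0 q1] z0.
have h1 : 0 <= z * (z - 1 / 2) ^+ 2 by rewrite mulr_ge0 ?sqr_ge0.
have h2 : 0 <= (6 - 3 * (p + q)) * (z - (p + q) / 2) ^+ 2.
  by rewrite mulr_ge0 ?sqr_ge0 //; lra.
have pp : 0 <= p * (1 - p) by rewrite mulr_ge0 ?subr_ge0.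
have h3 : 0 <= z * (19 / 4 + 4 * (p * (1 - p)) - 4 * q).
  by rewrite mulr_ge0 //; lra.
have h4 : 0 <= (6 - 2 * (p + q)) * (p - q) ^+ 2 / 4.
  by apply: divr_ge0 => //; apply: mulr_ge0; rewrite ?sqr_ge0 //; lra.
(* 18/11 minimises 3 - 3s + 11s^2/12 over s = p + q; this quadratic has negative discriminant. *)
have sq := sqr_ge0 (p + q - 18 / 11).
have h5 : 0 <= (p + q) * (3 - 3 * (p + q) + 11 / 12 * (p + q) ^+ 2).
  by rewrite mulr_ge0 //; lra.
lra.
Qed.

(* All Bernstein coefficients of bidegree (3, 3) on the unit square are
   nonnegative. *)
Lemma form_coef0_const_ge0 p q : 0 <= p <= 1 -> 0 <= q <= 1 ->
  0 <= 79 / 20 * (p + q) - 12 * p * q + 2 / 3 * (p + q) ^+ 2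
       - 20 / 27 * (p + q) ^+ 3 + 4 * p * q * (p + q)
       - (13 / 10 * q - p / 5) ^+ 2 * (8 - 4 * (p + q)) / 3.
Proof.
move=> /andP[p0 p1] /andP[q0 q1].
have H i j : 0 <= p ^+ i * (1 - p) ^+ (3 - i) * (q ^+ j * (1 - q) ^+ (3 - j)).
  by rewrite !mulr_ge0 ?exprn_ge0 ?subr_ge0.
have := (H 0 1, H 0 2, H 0 3, H 1 0, H 1 1, H 1 2, H 1 3, H 2 0)%N.
have := (H 2 1, H 2 2, H 2 3, H 3 0, H 3 1, H 3 2, H 3 3)%N.
rewrite /= !subnn !subn0 !subSS !subn0 /=.
move=> [[[[[[? ?] ?] ?] ?] ?] ?] [[[[[[[? ?] ?] ?] ?] ?] ?] ?].
lra.
Qed.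

Lemma form_coef0_ge p q z : 0 <= p <= 1 -> 0 <= q <= 1 -> 0 <= z ->
  (p + q + z ^+ 3) / 20 <=
    4 * (p + q) - 12 * p * q + 2 / 3 * (p + q) ^+ 2 - 20 / 27 * (p + q) ^+ 3
    + 4 * p * q * (p + q)
    + z * (- (16 / 3) * (p + q) + 20 / 9 * (p + q) ^+ 2 + 8 * p - 4 * p ^+ 2)
    + z ^+ 2 * (8 / 3 - 20 / 9 * (p + q)) + 20 / 27 * z ^+ 3.
Proof.
move=> Hp Hq z0; have h6 := form_coef0_const_ge0 Hp Hq.
move: Hp Hq => /andP[p0 p1] /andP[q0 q1].
have h1 : 0 <= z * (z - 2 / 3 * (p + q)) ^+ 2 by rewrite mulr_ge0 ?sqr_ge0.
(* Together with two thirds of [h1] this square takes up the whole z^2 term. The part free of z that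
   it leaves is exactly [h6]. *)
have h2 : 0 <= (8 - 4 * (p + q)) / 3 * (z - (13 / 10 * q - p / 5)) ^+ 2.
  by rewrite mulr_ge0 ?sqr_ge0 //; lra.
have h3 : 0 <= z * (p * (1 - p)) by rewrite !mulr_ge0 ?subr_ge0.
have h4 : 0 <= z * (q * (1 - q)) by rewrite !mulr_ge0 ?subr_ge0.
have h5 : 0 <= z * (p * q) by rewrite !mulr_ge0.
have h7 : 0 <= z * p by rewrite !mulr_ge0.
have h8 : 0 <= z * q by rewrite !mulr_ge0.
have h9 : 0 <= z ^+ 3 by rewrite exprn_ge0.
lra.
Qed.

(* The weight of all triples whose ranks (from 0) are not all at least t-1, 2t-1
   and 3t-1 respectively, when the t-1 vertices of lowest rank have weight a, the
   next t weight b, the next t weight c, and the others infinitesimal weights of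
   total z. *)
Definition star_link_form t (a b c z : R) : R :=
  (t - 1) * (t - 2) * (t - 3) / 6 * a ^+ 3
  + (t - 1) * (t - 2) / 2 * a ^+ 2 * (t * b + t * c)
  + (t - 1) * a * (t * (t - 1) / 2 * b ^+ 2 + t * b * (t * c)
                   + t * (t - 1) / 2 * c ^+ 2)
  + t * (t - 1) * (t - 2) / 6 * b ^+ 3 + t * (t - 1) / 2 * b ^+ 2 * (t * c)
  + t * b * (t * (t - 1) / 2 * c ^+ 2) + t * (t - 1) * (t - 2) / 6 * c ^+ 3
  + z * ((t - 1) * (t - 2) / 2 * a ^+ 2 + (t - 1) * a * (t * b + t * c)
         + t * (t - 1) / 2 * b ^+ 2)
  + (t - 1) * a * (z ^+ 2 / 2).

(* After normalising a = 1 and writing t = 2 + r, the difference of the two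
   sides is a quadratic polynomial in r with nonnegative coefficients. *)
Lemma star_link_form_le t (a b c z : R) :
  2 <= t -> 0 <= c <= a -> 0 <= b <= a -> 0 <= z ->
  star_link_form t a b c z
    + (t - 1) / 40 * (a ^+ 2 * (a - b + (a - c)) + (z / t) ^+ 3)
  <= (t - 1) * (3 * t - 1) * (3 * t - 2) / (54 * t ^+ 3)
     * (t * (a + b + c) + z) ^+ 3.
Proof.
move=> t2 /andP[c0 ca] /andP[b0 ba] z0.
have t0 : t != 0 by apply/eqP; lra.
(* Normalising by a is impossible when a = 0, but then b = c = 0 and only a multiple of z^3
   remains. *)
have [a0|a0] := eqVneq a 0.
  have -> : b = 0 by lra.
  have -> : c = 0 by lra.
  rewrite a0 /star_link_form -subr_ge0.
  rewrite [X in 0 <= X](_ : _ = (t - 1) * (z / t) ^+ 3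
    * ((3 * t - 1) * (3 * t - 2) / 54 - 1 / 40)); last by field; exact: t0.
  apply: mulr_ge0; last by nra.
  apply: mulr_ge0; first by lra.
  by rewrite exprn_ge0 // divr_ge0 //; lra.
have a_gt0 : 0 < a by rewrite lt_def a0; lra.
pose p := (a - b) / a; pose q := (a - c) / a; pose y := z / t / a.
have Eb : b = a * (1 - p) by rewrite /p; field; exact: a0.
have Ec : c = a * (1 - q) by rewrite /q; field; exact: a0.
have Ez : z = a * t * y by rewrite /y; field; rewrite a0 t0.
have Hp : 0 <= p <= 1.
  by rewrite /p divr_ge0 ?ler_pdivrMr ?mul1r //=; lra.
have Hq : 0 <= q <= 1.
  by rewrite /q divr_ge0 ?ler_pdivrMr ?mul1r //=; lra.
have Hy : 0 <= y by rewrite /y !divr_ge0 //; lra.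
move: p q y Eb Ec Ez Hp Hq Hy => p q y -> -> -> Hp Hq Hy.
have h0 := form_coef0_ge Hp Hq Hy.
have h1 := form_coef1_ge0 Hp Hq Hy.
have h2 : 0 <= y * ((1 - q) * (3 - q - 2 * p)) + y ^+ 2 * (2 - (p + q)) + y ^+ 3 / 3.
  move: Hp Hq => /andP[p0 p1] /andP[q0 q1].
  by rewrite !addr_ge0 ?mulr_ge0 ?exprn_ge0 ?invr_ge0 //; lra.
rewrite -subr_ge0 /star_link_form.
set h0' := (X in _ <= X) in h0; set h1' := (X in _ <= X) in h1.
set h2' := (X in _ <= X) in h2.
rewrite [X in 0 <= X](_ : _ = a ^+ 3 * ((t - 1) / 2)
  * ((t - 2) ^+ 2 * h2' + (t - 2) * h1' + (h0' - (p + q + y ^+ 3) / 20)));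
  last by rewrite /h0' /h1' /h2'; field; exact: t0.
apply: mulr_ge0.
  by apply: mulr_ge0; [rewrite exprn_ge0 // ltW | lra].
apply: addr_ge0; last by lra.
by rewrite addr_ge0 // mulr_ge0 ?sqr_ge0 //; lra.
Qed.

End FormInequality.

(** * Elementary symmetric sums and Maclaurin's inequality *)

Lemma finset_elim (T : finType) (P : {set T} -> Prop) :
  P set0 ->
  (forall v (A : {set T}), v \notin A -> P A -> P (v |: A)%SET) -> forall A, P A.
Proof.
move=> P0 PS A; elim: {A}#|A| {-2}A (erefl #|A|) => [|n IH] A cA.
  by move/eqP: cA; rewrite cards_eq0 => /eqP ->.
have /card_gt0P[v vA] : (0 < #|A|)%N by rewrite cA.
rewrite -(setD1K vA); apply: PS; first by rewrite !inE eqxx.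
by apply: IH; move: cA; rewrite (cardsD1 v) vA => -[].
Qed.

(** Convexity of the power function, in the tangent form that drives the induction of
    [maclaurin]. *)
Lemma expr_tangent_le (R : realFieldType) (n : nat) (y u : R) :
  0 <= y -> 0 <= u -> u ^+ n.+1 + n.+1%:R * u ^+ n * (y - u) <= y ^+ n.+1.
Proof.
move=> y0 u0; elim: n => [|n IH].
  by rewrite !expr1 expr0 !mul1r addrC subrK.
rewrite [y ^+ n.+2]exprS.
apply: le_trans (ler_wpM2l y0 IH).
rewrite -subr_ge0 [X in 0 <= X](_ : _ = n.+1%:R * u ^+ n * (y - u) ^+ 2).
  by apply: mulr_ge0 (sqr_ge0 _); rewrite mulr_ge0 ?exprn_ge0.
by rewrite -[n.+2%:R]natr1 -[n.+1%:R]natr1 !exprS; ring.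
Qed.

Section SubsetSums.
Variables (R : realFieldType) (V : finType) (x : V -> R).
Implicit Types (A U W : {set V}).

Definition elsym (k : nat) (A : {set V}) : R :=
  \sum_(e : {set V} | (e \subset A) && (#|e| == k)) \prod_(i in e) x i.

(** A subset e of the union corresponds to the pair of its traces on U and W, and its product
    factors accordingly. The predicates are kept general so that triples can later be classified by
    their position in the blocks. *)
Lemma sum_subset_split U W (P Q : pred {set V}) : [disjoint U & W] ->
  \sum_(e : {set V} | [&& e \subset (U :|: W)%SET, P (e :&: U)%SET
                        & Q (e :&: W)%SET]) \prod_(i in e) x i =
  (\sum_(e : {set V} | (e \subset U) && P e) \prod_(i in e) x i)
  * (\sum_(e : {set V} | (e \subset W) && Q e) \prod_(i in e) x i).
Proof.
move=> dUW; rewrite big_distrlr /= pair_big /=.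
rewrite [RHS](reindex_onto (fun e : {set V} => ((e :&: U)%SET, (e :&: W)%SET))
  (fun p => (p.1 :|: p.2)%SET)) /=; last first.
  move=> [e f] /= /andP[/andP[eU _] /andP[fW _]]; congr (_, _).
    rewrite setIUl (setIidPl eU) (_ : f :&: U = set0)%SET ?setU0 //.
    by apply: disjoint_setI0; rewrite disjoint_sym; apply: disjointWr dUW.
  rewrite setIUl (setIidPl fW) (_ : e :&: W = set0)%SET ?set0U //.
  by apply: disjoint_setI0; apply: disjointWl dUW.
apply: eq_big => [e|e /and3P[eUW _ _]].
  rewrite !subsetIr /= -setIUr; case: (boolP (e \subset _)) => [/setIidPl->|H] /=.
    by rewrite eqxx andbT.
  by apply/esym/negP => /andP[_ /eqP/setIidPl]; apply/negP.
rewrite -{1}(setIidPl eUW) setIUr -bigU //=.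
  by apply: eq_bigl => i; rewrite !inE.
by apply: disjointWl (subsetIr _ _) (disjointWr (subsetIr _ _) dUW).
Qed.

Lemma elsym_Vandermonde k U W : [disjoint U & W] ->
  elsym k (U :|: W)%SET = \sum_(i < k.+1) elsym i U * elsym (k - i) W.
Proof.
move=> dUW; rewrite {1}/elsym.
(* [inord] is faithful here, since the trace of a k-set has at most k elements. *)
rewrite (partition_big (fun e : {set V} => inord #|e :&: U|%SET : 'I_k.+1) predT) //=.
apply: eq_bigr => i _; rewrite -sum_subset_split //; apply: eq_bigl => e /=.
case: (boolP (e \subset _)) => //= eUW.
have E : #|e| = (#|e :&: U|%SET + #|e :&: W|%SET)%N.
  rewrite -{1}(setIidPl eUW) setIUr cardsU.
  rewrite (_ : (e :&: U) :&: (e :&: W) = set0)%SET ?cards0 ?subn0 //.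
  apply: disjoint_setI0.
  by apply: disjointWl (subsetIr _ _) (disjointWr (subsetIr _ _) dUW).
have ik := ltn_ord i; apply/andP/andP => [[/eqP ek]|[/eqP eU /eqP eW]].
  move/eqP/(congr1 val); rewrite /= inordK; last by lia.
  by move=> eU; split; apply/eqP; lia.
split; first by apply/eqP; lia.
by apply/eqP/val_inj; rewrite /= inordK; lia.
Qed.

Lemma elsym0 A : elsym 0 A = 1.
Proof.
rewrite /elsym (big_pred1 set0) ?big_set0 // => e.
by rewrite /= cards_eq0; case: (altP (e =P set0)) => [->|]; rewrite ?sub0set ?andbF.
Qed.

Lemma elsym_gt_card k A : (#|A| < k)%N -> elsym k A = 0.
Proof.
move=> Ak; rewrite /elsym big_pred0 // => e; apply/negP => /andP[/subset_leq_card].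
by move=> eA /eqP; lia.
Qed.

Lemma elsym1_set1 v : elsym 1 [set v]%SET = x v.
Proof.
rewrite /elsym (big_pred1 [set v]%SET) ?big_set1 // => e.
rewrite /= subset1; case: (altP (e =P [set v]%SET)) => [->|_] /=.
  by rewrite cards1.
by case: (altP (e =P set0)) => [->|] //=; rewrite cards0.
Qed.

Lemma elsymU1 k v A : v \notin A -> elsym k.+1 (v |: A)%SET = elsym k.+1 A + x v * elsym k A.
Proof.
move=> vA; rewrite elsym_Vandermonde ?disjoints1 // !big_ord_recl /=.
rewrite elsym0 mul1r elsym1_set1 subn0 /bump /= addn0 subn1 /= big1 ?addr0 // => i _.
by rewrite elsym_gt_card ?mul0r ?cards1.
Qed.

Lemma elsym1 A : elsym 1 A = \sum_(i in A) x i.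
Proof.
elim/finset_elim: A => [|v A vA IH]; first by rewrite big_set0 elsym_gt_card ?cards0.
by rewrite elsymU1 // IH elsym0 mulr1 big_setU1 //= addrC.
Qed.

Hypothesis x_ge0 : forall i, 0 <= x i.

Lemma elsym_ge0 k A : 0 <= elsym k A.
Proof. by apply: sumr_ge0 => e _; apply: prodr_ge0. Qed.

(** Induction on A, adding one vertex and using Pascal's rule. Allowing N to exceed the size of A
    amounts to padding with zero weights, so incomplete blocks need no separate treatment. *)
Lemma maclaurin k N A : (#|A| <= N)%N ->
  elsym k A <= 'C(N, k)%:R * ((\sum_(i in A) x i) / N%:R) ^+ k.
Proof.
elim/finset_elim: A k N => [|v A vA IH] k N cA.
  case: k => [|k]; first by rewrite elsym0 bin0 mul1r.
  by rewrite elsym_gt_card ?cards0 // mulr_ge0 ?exprn_ge0 ?big_set0 ?mul0r.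
move: cA; rewrite cardsU1 vA add1n => cA; case: N cA => // N; rewrite ltnS => cA.
case: k => [|k]; first by rewrite elsym0 bin0 mul1r.
rewrite elsymU1 // big_setU1 //=; set S := \sum_(i in A) x i.
have S0 : 0 <= S by apply: sumr_ge0.
pose u := S / N%:R; have u0 : 0 <= u by rewrite divr_ge0.
have Nu : N%:R * u = S.
  (* For N = 0 the set A is empty, so S = 0 as well. *)
  case: (posnP N) => [N0|N0]; last by rewrite /u mulrC divfK // pnatr_eq0 -lt0n.
  rewrite N0 mul0r /S; move: cA; rewrite N0 leqn0 cards_eq0 => /eqP ->.
  by rewrite big_set0.
have N1 : N.+1%:R != 0 :> R by rewrite pnatr_eq0.
have y0 : 0 <= (x v + S) / N.+1%:R by rewrite divr_ge0 ?addr_ge0.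
(* The tangent is taken at the old average u; its value at the new average is exactly the bound that
   the induction hypotheses give. *)
have T := @expr_tangent_le _ k _ _ y0 u0.
have := ler_wpM2l (ler0n R 'C(N.+1, k.+1)) T; apply: le_trans.
have := lerD (IH k.+1 N cA) (ler_wpM2l (x_ge0 v) (IH k N cA)); move/le_trans; apply.
rewrite -/S -/u le_eqVlt; apply/orP; left; apply/eqP.
rewrite mulrDr.
have E : 'C(N.+1, k.+1)%:R * k.+1%:R = N.+1%:R * 'C(N, k)%:R :> R.
  by rewrite -!natrM mulnC mul_bin_diag.
have -> : 'C(N.+1, k.+1)%:R * (k.+1%:R * u ^+ k * ((x v + S) / N.+1%:R - u)) =
   'C(N.+1, k.+1)%:R * k.+1%:R * (u ^+ k * ((x v + S) / N.+1%:R - u)) by ring.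
rewrite E binS natrD -Nu -natr1 exprS; field.
by rewrite natr1.
Qed.

End SubsetSums.

(** * Compression of set families *)

Section Shifting.
Variables (R : realFieldType) (V : finType).
Implicit Types (F : {set {set V}}) (e : {set V}) (u v w : V) (x : V -> R).

Definition has_matching k F := exists M : 'I_k -> {set V},
  (forall i, M i \in F) /\ (forall i j, i != j -> [disjoint M i & M j]).

Definition weight F x : R := \sum_(e in F) \prod_(i in e) x i.

Definition swap u v e : {set V} := (tperm u v @: e)%SET.

Lemma mem_swap u v e w : (w \in swap u v e) = (tperm u v w \in e).
Proof.
rewrite /swap -{1}(tpermK u v w).
by rewrite mem_imset //; exact: perm_inj.
Qed.

Lemma swapK u v : involutive (swap u v).
Proof. by move=> e; apply/setP => w; rewrite !mem_swap tpermK. Qed.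

Lemma card_swap u v e : #|swap u v e| = #|e|.
Proof. by apply: card_imset; exact: perm_inj. Qed.

Lemma swap_id u v e : (u \in e) = (v \in e) -> swap u v e = e.
Proof.
move=> E; apply/setP => w; rewrite mem_swap.
by case: tpermP => [->|->|//]; rewrite E.
Qed.

Lemma prod_swap u v e x :
  \prod_(i in swap u v e) x i = \prod_(i in e) x (tperm u v i).
Proof. by rewrite big_imset //= => i j _ _ /perm_inj. Qed.

(** The compression from v to u, described on each orbit of the swap: if F contains just one of two
    distinct swapped sets, the one containing u is kept; sets fixed by the swap are unaffected. *)
Definition shift u v F : {set {set V}} :=
  [set e : {set V} | if u \in e then (e \in F) || (swap u v e \in F)
             else (e \in F) && (swap u v e \in F)]%SET.

Lemma shift_uniform r u v F : (forall e, e \in F -> #|e| = r) ->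
  forall e, e \in shift u v F -> #|e| = r.
Proof.
move=> HF e; rewrite inE; case: ifP => _; last by case/andP => /HF.
by case/orP => /HF //; rewrite card_swap.
Qed.

(* If a matching of the shifted family is not already in F, then exactly one
   of its members contains u, and swapping u and v puts all of it into F. *)
Lemma shift_matching k u v F : has_matching k (shift u v F) -> has_matching k F.
Proof.
move=> [M [MF Md]]; have [MF'|] := boolP [forall i, M i \in F].
  by exists M; split => // i; exact: (forallP MF').
rewrite negb_forall => /existsP[i0 i0F].
have ui0 : u \in M i0.
  by have := MF i0; rewrite inE; case: ifP => // _; rewrite (negbTE i0F).
exists (fun i => swap u v (M i)); split=> [i|i j ij].
  have := MF i; rewrite inE; have [->|ii0] := eqVneq i i0.
    by rewrite ui0 (negbTE i0F).
  have -> : u \in M i = false.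
    exact: disjointFl (Md _ _ ii0) ui0.
  by case/andP.
rewrite -setI_eq0 /swap -imsetI; last by move=> ? ? _ _ /perm_inj.
by rewrite imset_eq0 setI_eq0 Md.
Qed.

Lemma prod_swap_le u v e x : (forall i, 0 <= x i) -> x v <= x u ->
  u \in e -> v \notin e -> \prod_(i in swap u v e) x i <= \prod_(i in e) x i.
Proof.
move=> x0 xuv ue ve; rewrite prod_swap; apply: ler_prod => i ie.
rewrite x0 /=; case: tpermP => [->|iv|//] //.
by rewrite -iv ie in ve.
Qed.

Lemma prod_swap_lt u v e x : (forall i, 0 < x i) -> x v < x u ->
  u \in e -> v \notin e -> \prod_(i in swap u v e) x i < \prod_(i in e) x i.
Proof.
move=> x0 xuv ue ve; rewrite prod_swap (bigD1 u) //= [ltRHS](bigD1 u) //= tpermL.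
have -> : \prod_(i in e | i != u) x (tperm u v i) = \prod_(i in e | i != u) x i.
  apply: eq_bigr => i /andP[ie iu]; rewrite tpermD //; first by rewrite eq_sym.
  by apply: contraNneq ve => ->.
by rewrite ltr_pM2r // prodr_gt0.
Qed.

Lemma weight_indicator F x :
  weight F x = \sum_(e : {set V}) (e \in F)%:R * \prod_(i in e) x i.
Proof.
rewrite /weight big_mkcond; apply: eq_bigr => e _.
by case: ifP; rewrite ?mul1r ?mul0r.
Qed.

(** Sets fixed by the swap cancel. Two distinct swapped sets contribute only when F contains just
    the one with v. Being exact, the formula gives both weak and strict monotonicity of the
    weight. *)
Lemma weight_shift_diff u v F x :
  weight (shift u v F) x - weight F x =
  \sum_(e : {set V} | (u \in e) && (v \notin e))
     ((swap u v e \in F) && (e \notin F))%:R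
     * (\prod_(i in e) x i - \prod_(i in swap u v e) x i).
Proof.
rewrite !weight_indicator -sumrB.
rewrite (bigID (fun e : {set V} => (u \in e) == (v \in e))) /= big1 ?add0r; last first.
  move=> e /eqP E; rewrite inE (swap_id E); case: ifP => _.
    by rewrite orbb subrr.
  by rewrite andbb subrr.
rewrite (bigID (fun e : {set V} => u \in e)) /= addrC.
rewrite (reindex_inj (inv_inj (swapK u v))) /=.
have Eb e : ((u \in swap u v e) != (v \in swap u v e)) && (u \notin swap u v e) =
            (u \in e) && (v \notin e).
  by rewrite !mem_swap tpermL tpermR; case: (u \in e); case: (v \in e).
have Eb2 e : ((u \in e) != (v \in e)) && (u \in e) = (u \in e) && (v \notin e).
  by case: (u \in e); case: (v \in e).
under eq_bigl do rewrite Eb; rewrite addrC; under eq_bigl do rewrite Eb2.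
rewrite -big_split /=; apply: eq_bigr => e /andP[ue ve].
rewrite !inE mem_swap tpermL ue (negbTE ve) swapK.
by case: (e \in F); case: (swap u v e \in F); rewrite /=; ring.
Qed.

Lemma weight_shift_le u v F x : (forall i, 0 <= x i) -> x v <= x u ->
  weight F x <= weight (shift u v F) x.
Proof.
move=> x0 xuv; rewrite -subr_ge0 weight_shift_diff; apply: sumr_ge0 => e.
by case/andP => ue ve; rewrite mulr_ge0 ?subr_ge0 ?prod_swap_le.
Qed.

Lemma weight_shift_lt u v F x e : (forall i, 0 < x i) -> x v < x u ->
  e \in F -> v \in e -> u \notin e -> swap u v e \notin F ->
  weight F x < weight (shift u v F) x.
Proof.
move=> x0 xuv eF ve ue sF; rewrite -subr_gt0 weight_shift_diff.
have us : u \in swap u v e by rewrite mem_swap tpermL.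
have vs : v \notin swap u v e by rewrite mem_swap tpermR.
rewrite (bigD1 (swap u v e)) ?us ?vs //= swapK eF sF mul1r ltr_wpDr //.
  apply: sumr_ge0 => f /andP[/andP[uf vf] _].
  by rewrite mulr_ge0 ?subr_ge0 ?prod_swap_le // ?ltW // => i; rewrite ltW.
by rewrite subr_gt0 -{1}(swapK u v e) prod_swap_lt.
Qed.

Variable rk : V -> nat.

Definition shifted F := forall u v e, (rk u < rk v)%N ->
  e \in F -> v \in e -> u \notin e -> swap u v e \in F.

(* Among the admissible families, one of maximal weight with respect to a
   strictly decreasing weighting is stable under all shifts. *)
Lemma exists_shifted r k F x :
  (forall i, 0 <= x i) -> (forall u v, (rk u < rk v)%N -> x v <= x u) ->
  (forall e, e \in F -> #|e| = r) -> ~ has_matching k F ->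
  exists F', [/\ forall e, e \in F' -> #|e| = r, ~ has_matching k F',
                 weight F x <= weight F' x & shifted F'].
Proof.
move=> x0 xrk Fr Fk.
pose P F' := `[< [/\ forall e, e \in F' -> #|e| = r, ~ has_matching k F'
                  & weight F x <= weight F' x] >].
(* Since x may have ties and zeros, strict progress is measured by y, which is positive and strictly
   decreasing in the rank. *)
pose y v : R := (\max_w rk w).+1%:R - (rk v)%:R.
have yE u : (rk u < (\max_w rk w).+1)%N by rewrite ltnS leq_bigmax.
have y0 u : 0 < y u by rewrite subr_gt0 ltr_nat.
have PF : P F by apply/asboolP; split.
case: (@Order.TotalTheory.arg_maxP _ _ _ F P (fun F' => weight F' y) PF) => F' PF' Fmax.
move/asboolP: PF' => [F'r F'k wF']; exists F'; split=> // u v e uv eF ve ue.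
apply/negPn/negP => sF.
suff /Fmax : P (shift u v F').
  apply/negP; rewrite -ltNge; apply: (weight_shift_lt y0 _ eF ve ue sF).
  by rewrite /y ltrD2l ltrN2 ltr_nat.
apply/asboolP; split.
- exact: shift_uniform.
- by move/shift_matching.
- by apply: le_trans wF' _; apply: weight_shift_le => //; exact: xrk.
Qed.

End Shifting.

(** * Small binomial coefficients and rankings by decreasing weight *)

Lemma natr_bin2 (R : realFieldType) n : 'C(n, 2)%:R = n%:R * (n%:R - 1) / 2 :> R.
Proof.
elim: n => [|n IH]; first by rewrite bin0n mul0r mul0r.
by rewrite binS natrD IH bin1 -natr1; field.
Qed.

Lemma natr_bin3 (R : realFieldType) n :
  'C(n, 3)%:R = n%:R * (n%:R - 1) * (n%:R - 2) / 6 :> R.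
Proof.
elim: n => [|n IH]; first by rewrite bin0n !mul0r.
by rewrite binS natrD IH natr_bin2 -natr1; field.
Qed.

Lemma natr_bin4 (R : realFieldType) n :
  'C(n, 4)%:R = n%:R * (n%:R - 1) * (n%:R - 2) * (n%:R - 3) / 24 :> R.
Proof.
elim: n => [|n IH]; first by rewrite bin0n !mul0r.
by rewrite binS natrD IH natr_bin3 -natr1; field.
Qed.

Lemma cards3 (T : finType) (a b c : T) (X : {set T}) :
  a != b -> a != c -> b != c ->
  #|([set a; b; c] :&: X)%SET| = ((a \in X) + (b \in X) + (c \in X))%N.
Proof.
move=> ab ac bc; rewrite -sum1_card.
rewrite (eq_bigl (fun i => (i \in [set a; b; c])%SET && (i \in X))); last first.
  by move=> i; rewrite inE.
rewrite big_mkcondr -setUA big_setU1 ?inE ?negb_or ?ab ?ac //=.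
rewrite big_setU1 ?inE //= big_set1.
by case: (a \in X); case: (b \in X); case: (c \in X).
Qed.

Section Ranking.
Variables (R : realFieldType) (V : finType).

Definition ranking (rk : V -> nat) :=
  [/\ injective rk, forall v, (rk v < #|V|)%N
    & forall i, (i < #|V|)%N -> exists v, rk v = i].

Lemma exists_ranking (x : V -> R) : exists2 rk : V -> nat, ranking rk
  & forall u v, (rk u < rk v)%N -> x v <= x u.
Proof.
pose le_x u v := x v <= x u; pose s := sort le_x (enum V).
have le_total : total le_x by move=> u v; exact: le_total.
have le_tr : transitive le_x by move=> u v w uv vw; exact: le_trans vw uv.
have ss : size s = #|V| by rewrite size_sort cardE.
have ms v : v \in s by rewrite mem_sort mem_enum.
have us : uniq s by rewrite sort_uniq enum_uniq.
exists (fun v => index v s); last first.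
  by move=> u v; apply: (sorted_ltn_index le_tr (sort_sorted le_total _)).
split=> [u v E|v|i iV].
- by rewrite -(nth_index u (ms u)) E nth_index.
- by rewrite -ss index_mem.
have [v0 _] : exists v0 : V, v0 \in V by apply/card_gt0P; apply: leq_ltn_trans iV.
by exists (nth v0 s i); rewrite index_uniq ?ss.
Qed.

Variable rk : V -> nat.
Hypothesis rk_ranking : ranking rk.

Definition rank_itv i j : {set V} := [set v : V | (i <= rk v < j)%N]%SET.

Lemma disjoint_rank_itv i j k l : (j <= k)%N ->
  [disjoint rank_itv i j & rank_itv k l].
Proof. by move=> jk; rewrite -setI_eq0; apply/eqP/setP => v; rewrite !inE; lia. Qed.

Lemma rank_itvU i j k : (i <= j <= k)%N ->
  (rank_itv i j :|: rank_itv j k)%SET = rank_itv i k.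
Proof. by move=> ijk; apply/setP => v; rewrite !inE; lia. Qed.

Lemma rank_itvC k : (~: rank_itv 0 k)%SET = rank_itv k #|V|.
Proof.
have [_ rk_lt _] := rk_ranking.
by apply/setP => v; rewrite !inE -leqNgt rk_lt andbT.
Qed.

Lemma card_rank_itv_le i j : (#|rank_itv i j| <= j - i)%N.
Proof.
have [rk_inj _ _] := rk_ranking.
rewrite -[X in (_ <= X)%N](size_iota i) cardE -(size_map rk).
apply: uniq_leq_size; first by rewrite map_inj_uniq ?enum_uniq.
move=> k /mapP[v]; rewrite mem_enum inE mem_iota => /andP[iv vj] ->.
by rewrite iv; lia.
Qed.

Lemma card_rank_itv_ge i j : (j <= #|V|)%N -> (j - i <= #|rank_itv i j|)%N.
Proof.
have [rk_inj _ rk_onto] := rk_ranking => jV.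
rewrite -[X in (X <= _)%N](size_iota i) cardE -[X in (_ <= X)%N](size_map rk).
apply: uniq_leq_size; first exact: iota_uniq.
move=> k; rewrite mem_iota => /andP[ik kj].
have [|v Ev] := rk_onto k; first by lia.
by rewrite -Ev map_f // mem_enum inE; lia.
Qed.

Lemma sum_le_card (x : V -> R) (X : {set V}) (k : nat) (c : R) : 0 <= c ->
  (#|X| <= k)%N -> (forall v, v \in X -> x v <= c) -> \sum_(v in X) x v <= k%:R * c.
Proof.
move=> c0 Xk Xc; apply: le_trans (ler_sum _ Xc) _.
by rewrite sumr_const -[c *+ _]mulr_natl ler_wpM2r ?ler_nat.
Qed.


(** The weight of the vertex of rank s separates the two averages; when no such vertex exists, the
    later interval is empty. Dividing by the nominal size t can only lower the left average. *)
Lemma avg_rank_itv_le (x : V -> R) (s t i j : nat) :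
  (forall v, 0 <= x v) -> (forall u v, (rk u < rk v)%N -> x v <= x u) ->
  (0 < s)%N -> (0 < t)%N -> (s <= i)%N -> (j - i <= t)%N ->
  (\sum_(v in rank_itv i j) x v) / t%:R <= (\sum_(v in rank_itv 0 s) x v) / s%:R.
Proof.
move=> x0 xrk s0 t0 si jit; have [rk_inj rk_lt rk_onto] := rk_ranking.
have [|sV] := leqP #|V| s => [Vs|].
  rewrite big1 ?mul0r ?divr_ge0 ?sumr_ge0 // => v.
  by rewrite inE; have := rk_lt v; lia.
have [w Ew] := rk_onto _ sV.
apply: (@le_trans _ _ (x w)).
  rewrite ler_pdivrMr ?ltr0n // mulrC; apply: sum_le_card => //.
    exact: leq_trans (card_rank_itv_le _ _) jit.
  move=> v; rewrite inE => /andP[iv _].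
  have [vw|vw] := eqVneq v w; first by rewrite vw.
  apply: xrk; have : rk v != rk w by apply: contraNneq vw => /rk_inj ->.
  by lia.
rewrite ler_pdivlMr ?ltr0n // mulrC.
have cA : (s <= #|rank_itv 0 s|)%N.
  by rewrite -{1}(subn0 s); apply: card_rank_itv_ge; exact: ltnW.
apply: (@le_trans _ _ (\sum_(v in rank_itv 0 s) x w)).
  by rewrite sumr_const -[x w *+ _]mulr_natl ler_wpM2r ?ler_nat.
by apply: ler_sum => v; rewrite inE => /andP[_ vs]; apply: xrk; rewrite Ew.
Qed.

End Ranking.

(** * Compressed triple systems without a large matching *)

Section ShiftedTriples.
Variables (R : realFieldType) (V : finType) (rk : V -> nat).
Hypothesis rk_ranking : ranking rk.
Variable F : {set {set V}}.
Hypotheses (F_shifted : shifted rk F) (F_card : forall e, e \in F -> #|e| = 3%N).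

Lemma shifted_replace (g : {set V}) u v : (rk u <= rk v)%N ->
  u \notin g -> v \notin g -> (v |: g)%SET \in F -> (u |: g)%SET \in F.
Proof.
have [rk_inj _ _] := rk_ranking => uv ug vg vgF.
have [->//|nuv] := eqVneq u v.
have ltuv : (rk u < rk v)%N.
  by rewrite ltn_neqAle uv andbT; apply: contraNneq nuv => /rk_inj ->.
have := F_shifted ltuv vgF (setU11 _ _).
rewrite !inE negb_or nuv ug => /(_ isT).
congr (_ \in F); apply/setP => w; rewrite mem_swap !inE.
case: tpermP => [->|->|/eqP wu /eqP wv].
- by rewrite !eqxx.
- by rewrite (negbTE nuv) (negbTE ug) eq_sym (negbTE nuv) (negbTE vg).
- by rewrite (negbTE wu) (negbTE wv).
Qed.

Lemma rank_lt_neq u v : (rk u < rk v)%N -> u != v.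
Proof. by apply: contraTneq => ->; rewrite ltnn. Qed.

(** The vertices are lowered one at a time, smallest rank first, which keeps the three ranks
    distinct throughout. *)
Lemma shifted_triple a b c a' b' c' :
  (rk a < rk b < rk c)%N -> (rk a' < rk b' < rk c')%N ->
  (rk a' <= rk a)%N -> (rk b' <= rk b)%N -> (rk c' <= rk c)%N ->
  [set a; b; c]%SET \in F -> [set a'; b'; c']%SET \in F.
Proof.
move=> abc abc' aa bb cc H.
have neq u v : (rk u < rk v)%N || (rk v < rk u)%N -> u != v.
  by case/orP => /rank_lt_neq //; rewrite eq_sym.
have E u v w : [set u; v; w]%SET = (u |: [set v; w])%SET by rewrite setUA.
have E2 u v w : (u |: [set v; w])%SET = (v |: [set u; w])%SET.
  by apply/setP => y; rewrite !inE; do !case: eqP.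
have E3 u v w : (u |: [set v; w])%SET = (w |: [set u; v])%SET.
  by apply/setP => y; rewrite !inE; do !case: eqP.
have n u v w : u != v -> u != w -> u \notin [set v; w]%SET.
  by move=> uv uw; rewrite !inE negb_or uv.
have H1 : (a' |: [set b; c])%SET \in F.
  apply: (@shifted_replace _ a' a aa); rewrite ?n -?E ?neq //; lia.
have H2 : (b' |: [set a'; c])%SET \in F.
  rewrite E2 in H1; apply: (@shifted_replace _ b' b bb); rewrite ?n ?neq //; lia.
rewrite E E3; rewrite E2 E3 in H2.
apply: (@shifted_replace _ c' c cc); rewrite ?n ?neq //; lia.
Qed.

(** Otherwise, with t = s + 1, the triples of ranks i, t + i, 2t + i for i < t all lie below the
    given triple, hence in F, and they form a matching of size t. *)
Lemma shifted_position s a b c : ~ has_matching s.+1 F ->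
  (rk a < rk b < rk c)%N -> [set a; b; c]%SET \in F ->
  [|| rk a < s, rk b < s.*2.+1 | rk c < (3 * s).+2]%N.
Proof.
have [rk_inj rk_lt rk_onto] := rk_ranking => noM abc abcF.
apply/negPn/negP; rewrite !negb_or -!leqNgt => /and3P[sa sb sc]; apply: noM.
(* The default [a] is never reached for ranks up to 3s + 2, which are at most the rank of c. *)
pose f i := odflt a [pick v | rk v == i].
have cV := rk_lt c.
have fE i : (i <= (3 * s).+2)%N -> rk (f i) = i.
  move=> i_le; rewrite /f; case: pickP => [v /eqP //|] /= none.
  by have [|v Ev] := rk_onto i; [lia | have := none v; rewrite Ev eqxx].
exists (fun i : 'I_s.+1 => [set f i; f (s.+1 + i)%N; f (s.*2.+2 + i)%N]%SET).
split=> [i|i j ij].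
  have := ltn_ord i => is1.
  by apply: (shifted_triple abc _ _ _ _ abcF); rewrite !fE; lia.
have nij : (i != j :> nat) := ij.
have := ltn_ord i; have := ltn_ord j => js1 is1.
rewrite -setI_eq0; apply/eqP/setP => w; rewrite !inE -orbA.
by apply/negP => /andP[/or3P[] /eqP ->]; rewrite -!(inj_eq rk_inj) !fE; lia.
Qed.

Lemma card3_ranked (e : {set V}) : #|e| = 3%N ->
  exists a b c, (rk a < rk b < rk c)%N /\ e = [set a; b; c]%SET.
Proof.
have [rk_inj _ _] := rk_ranking => e3.
pose r := sort (fun u v => rk u <= rk v)%N (enum e).
have rE v : (v \in r) = (v \in e) by rewrite mem_sort mem_enum.
have ru : uniq r by rewrite sort_uniq enum_uniq.
have rs : sorted (fun u v => rk u <= rk v)%N r.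
  by apply: sort_sorted => u v; exact: leq_total.
have : size r = 3%N by rewrite size_sort -cardE.
case: r rE ru rs => [|a [|b [|c []]]] //= rE.
rewrite !inE !negb_or -!(inj_eq rk_inj) !andbT => /andP[/andP[ab ac] bc] /andP[le_ab le_bc] _.
exists a, b, c; split; first by lia.
by apply/setP => w; rewrite -rE !inE orbA.
Qed.

Variables (x : V -> R) (s : nat).
Hypothesis x_ge0 : forall v, 0 <= x v.

(** With t = s + 1 the cuts are t - 1, 2t - 1 and 3t - 1; D is made of the second and third blocks,
    of which B is the second. *)
Let A := rank_itv rk 0 s.
Let B := rank_itv rk s s.*2.+1.
Let D := rank_itv rk s (3 * s).+2.
Let W := rank_itv rk 0 (3 * s).+2.
Let Z := rank_itv rk (3 * s).+2 #|V|.

(** The terms list the positions allowed by [shifted_position]. A triple with one vertex in Z has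
    its other two both in A, one in A and one in D, or both in B; a triple with two vertices in Z
    has its third in A. *)
Lemma shifted_weight_le : ~ has_matching s.+1 F ->
  weight F x <= elsym x 3 W
    + elsym x 1 Z * (elsym x 2 A + elsym x 1 A * elsym x 1 D + elsym x 2 B)
    + elsym x 1 A * elsym x 2 Z.
Proof.
have [rk_inj rk_lt _] := rk_ranking => noM.
pose c0 (e : {set V}) := (e \subset W) && (#|e| == 3%N).
pose cls (k : nat) (Q : pred {set V}) (e : {set V}) :=
  [&& e \subset (Z :|: W)%SET, #|e :&: Z|%SET == k & Q (e :&: W)%SET].
pose qAD (i j : nat) (g : {set V}) := (#|g :&: A|%SET == i) && (#|g :&: D|%SET == j).
pose qB (g : {set V}) := (g \subset B) && (#|g| == 2%N).
pose f (e : {set V}) : R := \prod_(i in e) x i.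
have f0 e : 0 <= f e by apply: prodr_ge0.
have WE : W = (A :|: D)%SET by rewrite rank_itvU //; lia.
have dZW : [disjoint Z & W] by rewrite disjoint_sym disjoint_rank_itv.
have clsE k Q : \sum_(e | cls k Q e) f e =
    elsym x k Z * \sum_(g : {set V} | (g \subset W) && Q g) f g.
  by rewrite /cls (@sum_subset_split _ _ x Z W (fun g => #|g| == k) Q dZW).
have qADE i j : \sum_(g : {set V} | (g \subset W) && qAD i j g) f g =
    elsym x i A * elsym x j D.
  have dAD : [disjoint A & D] by exact: disjoint_rank_itv.
  by rewrite -(@sum_subset_split _ _ x _ _ (fun g => #|g| == i) (fun g => #|g| == j) dAD) WE.
have qBE : \sum_(g : {set V} | (g \subset W) && qB g) f g = elsym x 2 B.
  apply: eq_bigl => g; rewrite /qB; case: (boolP (g \subset B)); rewrite ?andbF //.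
  move=> gB; rewrite (subset_trans gB) //.
  by apply/subsetP => v; rewrite !inE; lia.
have -> : elsym x 3 W
      + elsym x 1 Z * (elsym x 2 A + elsym x 1 A * elsym x 1 D + elsym x 2 B)
      + elsym x 1 A * elsym x 2 Z
    = \sum_(e : {set V}) (c0 e + cls 1%N (qAD 2 0) e + cls 1%N (qAD 1 1) e
        + cls 1%N qB e + cls 2%N (qAD 1 0) e)%N%:R * f e.
  have S (P : pred {set V}) : \sum_(e : {set V}) (P e)%:R * f e = \sum_(e | P e) f e.
    by rewrite [RHS]big_mkcond; apply: eq_bigr => e _; case: ifP; rewrite ?mul1r ?mul0r.
  under eq_bigr do rewrite !natrD !mulrDl.
  by rewrite !big_split /= !S !clsE !qADE qBE !elsym0 /elsym /c0; ring.
(* The comparison is now edge by edge: each triple of F must fall into at least one of the five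
   classes. *)
rewrite weight_indicator; apply: ler_sum => e _; rewrite ler_wpM2r ?f0 // ler_nat.
case: (boolP (e \in F)) => // eF.
have [a [b [c [abc Ee]]]] := card3_ranked (F_card eF).
have pos : [|| rk a < s, rk b < s.*2.+1 | rk c < (3 * s).+2]%N.
  by apply: (shifted_position noM abc); rewrite -Ee.
have ab : a != b by apply: rank_lt_neq; lia.
have ac : a != c by apply: rank_lt_neq; lia.
have bc : b != c by apply: rank_lt_neq; lia.
have eW : e \subset (Z :|: W)%SET.
  by apply/subsetP => v _; rewrite !inE rk_lt andbT leqNgt orNb.
have cI X : #|e :&: X|%SET = ((a \in X) + (b \in X) + (c \in X))%N.
  by rewrite Ee cards3.
have WA : (e :&: W :&: A = e :&: A)%SET.
  by rewrite -setIA WE; congr (_ :&: _)%SET; apply/setIidPr; exact: subsetUl.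
have WD : (e :&: W :&: D = e :&: D)%SET.
  by rewrite -setIA WE; congr (_ :&: _)%SET; apply/setIidPr; exact: subsetUr.
have mA v : (v \in A) = (rk v < s)%N by rewrite inE.
have mD v : (v \in D) = (s <= rk v < (3 * s).+2)%N by rewrite inE.
have mW v : (v \in W) = (rk v < (3 * s).+2)%N by rewrite inE.
have mZ v : (v \in Z) = ~~ (rk v < (3 * s).+2)%N by rewrite inE rk_lt andbT leqNgt.
rewrite /cls /qAD /qB eW WA WD !cI /=.
have eWP : c0 e = (rk c < (3 * s).+2)%N.
  rewrite /c0 (F_card eF) eqxx andbT Ee; apply/subsetP/idP => [H|H v].
    by have := H c; rewrite mW; apply; rewrite !inE eqxx orbT.
  by rewrite mW !inE -orbA => /or3P[] /eqP ->; lia.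
have eBP : (rk a >= s)%N -> (rk b < s.*2.+1)%N -> ~~ (rk c < (3 * s).+2)%N ->
    (e :&: W \subset B)%SET.
  move=> sa sb sc; apply/subsetP => v; rewrite inE Ee mW !inE -orbA.
  by case/andP => /or3P[] /eqP -> H; lia.
rewrite eWP !mA !mD !mW !mZ; move: eBP.
have [c_lt|c_ge] //= := ltnP (rk c) (3 * s).+2; rewrite andbF.
have -> : (rk c < s)%N = false by apply/negbTE; lia.
have [b_lt|b_ge] := ltnP (rk b) (3 * s).+2; last first.
  have -> : (rk a < s)%N by lia.
  have -> : (rk a < (3 * s).+2)%N by lia.
  have -> : (rk b < s)%N = false by apply/negbTE; lia.
  have -> : (s <= rk a)%N = false by apply/negbTE; lia.
  by rewrite /= !andbF.
have -> : (rk a < (3 * s).+2)%N by lia.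
have [a_s|a_s] := ltnP (rk a) s; first by case: (ltnP (rk b) s).
have -> : (rk b < s)%N = false by apply/negbTE; lia.
by move=> -> //; lia.
Qed.

End ShiftedTriples.

(** * The weight of a 3-graph without t disjoint edges *)

Section LinkBound.
Variables (R : realFieldType) (V : finType) (x : V -> R).
Hypothesis x_ge0 : forall v, 0 <= x v.

(** Maclaurin with the size of X sent to infinity; it serves the last block, whose size is not
    controlled. *)
Lemma elsym2_le (X : {set V}) : elsym x 2 X <= (\sum_(v in X) x v) ^+ 2 / 2.
Proof.
apply: le_trans (maclaurin x_ge0 2 (leqnn #|X|)) _.
rewrite natr_bin2; set S := \sum_(v in X) x v; set n := #|X|%:R : R.
have [n0|n0] := eqVneq n 0.
  by rewrite n0 !mul0r divr_ge0 ?sqr_ge0.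
rewrite -subr_ge0 [X in 0 <= X](_ : _ = (S / n) ^+ 2 * n / 2); last by field; exact: n0.
by apply: divr_ge0 => //; apply: mulr_ge0 (sqr_ge0 _) (ler0n _ _).
Qed.

Lemma elsym_union3 (U W : {set V}) : [disjoint U & W] ->
  elsym x 3 (U :|: W)%SET =
    elsym x 3 W + elsym x 1 U * elsym x 2 W + elsym x 2 U * elsym x 1 W + elsym x 3 U.
Proof.
move=> dUW; rewrite elsym_Vandermonde // !big_ord_recl big_ord0 /bump /=.
by rewrite !elsym0 ?addn0 addr0 ?subSS ?subn0 mul1r mulr1 !addrA.
Qed.

Lemma elsym_union2 (U W : {set V}) : [disjoint U & W] ->
  elsym x 2 (U :|: W)%SET =
    elsym x 2 W + elsym x 1 U * elsym x 1 W + elsym x 2 U.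
Proof.
move=> dUW; rewrite elsym_Vandermonde // !big_ord_recl big_ord0 /bump /=.
by rewrite !elsym0 ?addn0 addr0 ?subSS ?subn0 mul1r mulr1 !addrA.
Qed.

Lemma elsym_union1 (U W : {set V}) : [disjoint U & W] ->
  elsym x 1 (U :|: W)%SET = elsym x 1 W + elsym x 1 U.
Proof.
move=> dUW; rewrite elsym_Vandermonde // !big_ord_recl big_ord0 /bump /=.
by rewrite !elsym0 ?addn0 addr0 ?subSS ?subn0 mul1r mulr1.
Qed.

(** The numbers a, b, c are block sums divided by the nominal sizes t - 1, t, t, and W is the union
    of these blocks. The family is compressed, but W, a, b, c depend only on the ranking of x. *)
Lemma matching_free_weight_le (t : nat) (F : {set {set V}}) (m : R) :
  (2 <= t)%N -> 0 <= m -> (forall v, x v <= m) ->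
  (forall e, e \in F -> #|e| = 3%N) -> ~ has_matching t F ->
  exists (W : {set V}) (a b c : R),
  [/\ (#|W| <= (3 * t).-1)%N,
      [/\ 0 <= c <= a, 0 <= b <= a & a <= m],
      \sum_(v in W) x v = (t%:R - 1) * a + t%:R * b + t%:R * c
    & let z := \sum_(v in ~: W) x v in
      weight F x
        + (t%:R - 1) / 40 * (a ^+ 2 * (a - b + (a - c)) + (z / t%:R) ^+ 3)
      <= (t%:R - 1) * (3 * t%:R - 1) * (3 * t%:R - 2) / (54 * t%:R ^+ 3)
         * (t%:R * (a + b + c) + z) ^+ 3].
Proof.
case: t => [|s] // s1; have s0 : (0 < s)%N by [].
have e1 : (s.*2.+1 - s <= s.+1)%N by lia.
have e2 : ((3 * s).+2 - s.*2.+1 <= s.+1)%N by lia.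
have e3 : ((3 * s).+2 - 0 <= (3 * s.+1).-1)%N by lia.
have e4 : (s <= s.*2.+1 <= (3 * s).+2)%N by lia.
have e5 : (0 <= s <= (3 * s).+2)%N by lia.
move=> m0 xm F3 FM; have [rk rkR rkx] := exists_ranking x.
have [F' [F'3 F'M wF F'sh]] := exists_shifted x_ge0 rkx F3 FM.
have := shifted_weight_le rkR F'sh F'3 x_ge0 F'M.
set A := rank_itv rk 0 s; set B := rank_itv rk s s.*2.+1.
set D := rank_itv rk s _; set W := rank_itv rk 0 _; set Z := rank_itv rk _ #|V| => wF'.
pose C := rank_itv rk s.*2.+1 (3 * s).+2.
have WE : W = (A :|: D)%SET by rewrite rank_itvU.
have DE : D = (B :|: C)%SET by rewrite rank_itvU.
have dA : [disjoint A & D] by exact: disjoint_rank_itv.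
have dB : [disjoint B & C] by exact: disjoint_rank_itv.
have ZE : Z = (~: W)%SET by rewrite rank_itvC.
have cA : (#|A| <= s)%N by rewrite -[X in (_ <= X)%N]subn0 card_rank_itv_le.
have cB : (#|B| <= s.+1)%N by exact: leq_trans (card_rank_itv_le rkR _ _) e1.
have cC : (#|C| <= s.+1)%N by exact: leq_trans (card_rank_itv_le rkR _ _) e2.
have sn0 : s%:R != 0 :> R by rewrite pnatr_eq0 -lt0n.
have tn0 : s.+1%:R != 0 :> R by rewrite pnatr_eq0.
pose a := (\sum_(v in A) x v) / s%:R.
pose b := (\sum_(v in B) x v) / s.+1%:R.
pose c := (\sum_(v in C) x v) / s.+1%:R.
have EA : elsym x 1 A = s%:R * a by rewrite elsym1 /a mulrC divfK.
have EB : elsym x 1 B = s.+1%:R * b by rewrite elsym1 /b mulrC divfK.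
have EC : elsym x 1 C = s.+1%:R * c by rewrite elsym1 /c mulrC divfK.
pose z := \sum_(v in ~: W) x v.
have EZ : elsym x 1 Z = z by rewrite elsym1 ZE.
have a0 : 0 <= a by rewrite divr_ge0 ?sumr_ge0.
have b0 : 0 <= b by rewrite divr_ge0 ?sumr_ge0.
have c0 : 0 <= c by rewrite divr_ge0 ?sumr_ge0.
have z0 : 0 <= z by rewrite sumr_ge0.
have ba : b <= a by exact: avg_rank_itv_le.
have ca : c <= a by apply: avg_rank_itv_le => //; case/andP: e4.
exists W, a, b, c; split.
- exact: leq_trans (card_rank_itv_le rkR _ _) e3.
- split; rewrite ?c0 ?b0 //.
  rewrite /a ler_pdivrMr ?ltr0n // mulrC; exact: sum_le_card.
- rewrite -elsym1 WE elsym_union1 // DE elsym_union1 // EA EB EC -natr1; ring.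
move=> z'; rewrite -/z.
have t2 : 2 <= s.+1%:R :> R by rewrite (ler_nat R 2).
apply: le_trans _ (@star_link_form_le R s.+1%:R a b c z t2 _ _ z0); rewrite ?c0 ?b0 //.
rewrite lerD2r; apply: le_trans wF _; apply: le_trans wF' _.
rewrite WE elsym_union3 // DE elsym_union3 // elsym_union2 // elsym_union1 //.
rewrite EA EB EC EZ /star_link_form.
have A2 := maclaurin x_ge0 2 cA; have A3 := maclaurin x_ge0 3 cA.
have B2 := maclaurin x_ge0 2 cB; have B3 := maclaurin x_ge0 3 cB.
have C2 := maclaurin x_ge0 2 cC; have C3 := maclaurin x_ge0 3 cC.
have Z2 := elsym2_le Z.
rewrite -elsym1 EZ in Z2.
move: A2 A3 B2 B3 C2 C3; rewrite -/a -/b -/c !natr_bin2 !natr_bin3.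
have -> : s%:R = s.+1%:R - 1 :> R by rewrite -natr1 addrK.
move: t2 {sn0 tn0 EA EB EC EZ}; set t := s.+1%:R => t2.
move=> A2 A3 B2 B3 C2 C3.
(* Each Maclaurin bound is multiplied by the nonnegative factor it meets in the form, which leaves a
   linear comparison. *)
have M1 := ler_wpM2r (mulr_ge0 (le_trans (ler0n _ 2) t2) b0) A2.
have M2 := ler_wpM2r (mulr_ge0 (le_trans (ler0n _ 2) t2) c0) A2.
have ta : 0 <= (t - 1) * a by rewrite mulr_ge0 //; lra.
have M3 := ler_wpM2l ta B2; have M4 := ler_wpM2l ta C2.
have tb : 0 <= t * b by rewrite mulr_ge0 //; lra.
have tc : 0 <= t * c by rewrite mulr_ge0 //; lra.
have M5 := ler_wpM2r tc B2; have M6 := ler_wpM2l tb C2.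
have M7 := ler_wpM2l z0 A2; have M8 := ler_wpM2l z0 B2.
have M9 := ler_wpM2l ta Z2.
lra.
Qed.

End LinkBound.

(** * Links, first-order optimality and stars *)

Section Link.
Variables (R : realType) (r : nat) (V : finType) (G : ugraph r V).
Implicit Types (x y : V -> R) (u v : V).

(** The partial derivative of [lagrange_poly G] in the variable [x u]. *)
Definition link_weight x u : R :=
  \sum_(e in edges G | u \in e) \prod_(i in (e :\ u)%SET) x i.

Lemma lagrange_poly_bilinear x y u v : u != v ->
  (forall i, i != u -> i != v -> y i = x i) ->
  lagrange_poly G y =
    y u * y v * (\sum_(e in edges G | (u \in e) && (v \in e))
                   \prod_(i in (e :\ u :\ v)%SET) x i)
    + y u * (\sum_(e in edges G | (u \in e) && (v \notin e))
               \prod_(i in (e :\ u)%SET) x i)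
    + y v * (\sum_(e in edges G | (u \notin e) && (v \in e))
               \prod_(i in (e :\ v)%SET) x i)
    + \sum_(e in edges G | (u \notin e) && (v \notin e)) \prod_(i in e) x i.
Proof.
move=> uv yx; rewrite /lagrange_poly.
rewrite (bigID (fun e : {set V} => u \in e)) /=.
rewrite (bigID (fun e : {set V} => v \in e)) /=.
rewrite [X in _ + X](bigID (fun e : {set V} => v \in e)) /= addrA.
rewrite !mulr_sumr; congr (_ + _ + _ + _).
- apply: eq_big => [e|e /andP[/andP[_ ue] ve]]; first by rewrite andbA.
  rewrite (big_setD1 u) //= (big_setD1 v) /=; last by rewrite !inE eq_sym uv.
  by rewrite mulrA; congr (_ * _); apply: eq_bigr => i; rewrite !inE => /and3P[? ? _]; exact: yx.
- apply: eq_big => [e|e /andP[/andP[_ ue] ve]]; first by rewrite andbA.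
  rewrite (big_setD1 u) //=; congr (_ * _); apply: eq_bigr => i.
  rewrite !inE => /andP[iu ie]; apply: yx => //.
  by apply: contraNneq ve => <-.
- apply: eq_big => [e|e /andP[/andP[_ ue] ve]]; first by rewrite andbA.
  rewrite (big_setD1 v) //=; congr (_ * _); apply: eq_bigr => i.
  rewrite !inE => /andP[iv ie]; apply: yx => //.
  by apply: contraNneq ue => <-.
- apply: eq_big => [e|e /andP[/andP[_ ue] ve]]; first by rewrite andbA.
  apply: eq_bigr => i ie; apply: yx.
    by apply: contraNneq ue => <-.
  by apply: contraNneq ve => <-.
Qed.

Lemma link_weight_split x u v : u != v ->
  link_weight x u =
    x v * (\sum_(e in edges G | (u \in e) && (v \in e))
             \prod_(i in (e :\ u :\ v)%SET) x i)
    + \sum_(e in edges G | (u \in e) && (v \notin e)) \prod_(i in (e :\ u)%SET) x i.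
Proof.
move=> uv; rewrite /link_weight (bigID (fun e : {set V} => v \in e)) /= mulr_sumr.
congr (_ + _); apply: eq_big => [e|e]; rewrite ?andbA // => /andP[/andP[_ ue] ve].
by rewrite (big_setD1 v) //= !inE eq_sym uv.
Qed.

(** Moving weight eps from v to u changes the polynomial by eps times the difference of the link
    weights, minus eps^2 times [c2]. Optimality makes this nonpositive, and eps can be taken
    arbitrarily small because [x v] is positive. *)
Lemma link_weight_le_max x v u : simplex R V x ->
  (forall y, simplex R V y -> lagrange_poly G y <= lagrange_poly G x) ->
  0 < x v -> link_weight x u <= link_weight x v.
Proof.
move=> [x0 x1] xmax xv; have [->//|uv] := eqVneq u v.
set c2 := \sum_(e in edges G | (u \in e) && (v \in e))
             \prod_(i in (e :\ u :\ v)%SET) x i.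
have c20 : 0 <= c2 by apply: sumr_ge0 => e _; apply: prodr_ge0.
suff H (eps : R) : 0 < eps -> eps <= x v -> link_weight x u - link_weight x v <= eps * c2.
  rewrite -subr_le0; rewrite leNgt; apply/negP => dpos.
  have [c2z|c2n] := eqVneq c2 0.
    by have := H _ xv (lexx _); rewrite c2z mulr0 leNgt dpos.
  have c2p : 0 < c2 by rewrite lt_def c2n.
  set d := link_weight x u - link_weight x v in dpos H *.
  (* This makes eps * c2 at most d/2, against the bound d <= eps * c2 given by [H]. *)
  pose eps := Num.min (x v) (d / c2 / 2).
  have eps0 : 0 < eps by rewrite lt_min xv !divr_gt0.
  have epsv : eps <= x v by rewrite ge_min lexx.
  have := H _ eps0 epsv.
  have : eps * c2 <= d / 2.
    rewrite -[leRHS](mulfVK c2n) ler_pM2r // ge_min; apply/orP; right.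
    by rewrite le_eqVlt; apply/orP; left; apply/eqP; ring.
  lra.
move=> e0 ev.
pose y i := if i == u then x u + eps else if i == v then x v - eps else x i.
have yS : simplex R V y.
  split=> [i|].
    rewrite /y; case: ifP => _; first by rewrite addr_ge0 // ltW.
    by case: ifP => _ //; rewrite subr_ge0.
  rewrite -x1 (bigD1 u) //= (bigD1 v) 1?eq_sym //= [RHS](bigD1 u) //=.
  rewrite [X in _ = _ + X](bigD1 v) 1?eq_sym //= /y eqxx eq_sym (negbTE uv) eqxx.
  rewrite (eq_bigr x); last by move=> i /andP[/negbTE-> /negbTE->].
  ring.
have := xmax _ yS; rewrite (@lagrange_poly_bilinear x y u v) //; last first.
  by move=> i /negbTE iu /negbTE iv; rewrite /y iu iv.
rewrite (@lagrange_poly_bilinear x x u v) // (link_weight_split _ uv).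
have vu : v != u by rewrite eq_sym.
rewrite (link_weight_split _ vu) -/c2.
have -> : \sum_(e in edges G | (v \in e) && (u \in e))
    \prod_(i in (e :\ v :\ u)%SET) x i = c2.
  apply: eq_big => [e|e _]; first by rewrite [(v \in e) && _]andbC.
  by apply: eq_bigl => i; rewrite !inE andbCA.
have -> : \sum_(e in edges G | (v \in e) && (u \notin e)) \prod_(i in (e :\ v)%SET) x i
  = \sum_(e in edges G | (u \notin e) && (v \in e)) \prod_(i in (e :\ v)%SET) x i.
  by apply: eq_bigl => e; rewrite [(v \in e) && _]andbC.
rewrite /y eqxx eq_sym (negbTE uv) eqxx.
set cu := \sum_(e in edges G | (u \in e) && (v \notin e)) _.
set cv := \sum_(e in edges G | (u \notin e) && (v \in e)) _.
set c0 := \sum_(e in edges G | _) _ => H.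
by rewrite -(ler_pM2l e0); clearbody cu cv c0 c2; lra.
Qed.

(** Euler's identity for homogeneous polynomials: each edge is counted once for each of its r
    vertices. *)
Lemma sum_link_weight x :
  \sum_u x u * link_weight x u = r%:R * lagrange_poly G x.
Proof.
under eq_bigr do rewrite /link_weight mulr_sumr.
rewrite /lagrange_poly mulr_sumr.
under eq_bigr do rewrite big_mkcondr.
rewrite exchange_big /=; apply: eq_bigr => e eG.
rewrite -big_mkcond /= (eq_bigr (fun=> \prod_(i in e) x i)).
  by rewrite sumr_const (edge_card eG) mulr_natl.
by move=> u ue; rewrite [RHS](big_setD1 u).
Qed.

Lemma lagrange_poly_le_link x v : simplex R V x ->
  (forall y, simplex R V y -> lagrange_poly G y <= lagrange_poly G x) ->
  0 < x v -> r%:R * lagrange_poly G x <= link_weight x v.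
Proof.
move=> xS xmax xv; rewrite -sum_link_weight.
apply: le_trans (_ : \sum_u x u * link_weight x v <= _).
  by apply: ler_sum => u _; rewrite ler_wpM2l ?link_weight_le_max //; case: xS.
by rewrite -mulr_suml; case: xS => _ ->; rewrite mul1r.
Qed.

Definition link_edges v : {set {set V}} :=
  [set (e :\ v)%SET | e in [set e in edges G | v \in e]%SET]%SET.

Lemma mem_link_edges v g : g \in link_edges v -> v \notin g /\ (v |: g)%SET \in edges G.
Proof.
case/imsetP => e; rewrite inE => /andP[eG ve] ->.
by rewrite setD1K // !inE eqxx.
Qed.

Lemma link_edges_mem v (g : {set V}) : v \notin g -> (v |: g)%SET \in edges G -> g \in link_edges v.
Proof.
move=> vg gG; apply/imsetP; exists (v |: g)%SET; first by rewrite !inE eqxx gG.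
by rewrite setU1K.
Qed.

Lemma card_link_edges v g : g \in link_edges v -> (#|g|.+1 = r)%N.
Proof. by case/mem_link_edges => vg /edge_card; rewrite cardsU1 vg. Qed.

(** Link edges avoid v, so setting its weight to 0 is harmless here, while it removes [x v] from the
    total mass seen by [matching_free_weight_le]. *)
Lemma weight_link_edges x v :
  weight (link_edges v) (fun i => if i == v then 0 else x i) = link_weight x v.
Proof.
rewrite /weight /link_edges big_imset /=; last first.
  move=> e f; rewrite !inE => /andP[_ ve] /andP[_ vf] E.
  by rewrite -(setD1K ve) E setD1K.
apply: eq_big => [e|e _]; first by rewrite inE.
by apply: eq_bigr => i; rewrite !inE => /andP[/negbTE-> _].
Qed.

End Link.

(** Adding v to the members of the matching gives a star centred at v; the enumeration of each
    member names the leaves. *)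
Lemma link_matching_star (V : finType) (s t : nat) (G : ugraph s.+1 V) (v : V) :
  has_matching t (link_edges G v) -> contains G (linear_star s t).
Proof.
move=> [M [MF Md]].
have Mc i : #|M i| = s by have := card_link_edges (MF i) => -[].
have Mv i : v \notin M i by case: (mem_link_edges (MF i)).
have Ms i : size (enum (M i)) = s by rewrite -cardE.
pose f (o : option ('I_t * 'I_s)) := if o is Some (i, j) then nth v (enum (M i)) j else v.
have fM i j : f (Some (i, j)) \in M i by rewrite -mem_enum mem_nth // Ms.
exists f.
  move=> [[i j]|] [[i' j']|] //.
  - move=> E; have Ei : i = i'.
      apply/eqP/negPn/negP => ii'; have := fM i' j'; rewrite -E.
      by rewrite (disjointFr (Md _ _ ii')).
    move: E; rewrite -Ei /f => /eqP; rewrite nth_uniq ?Ms ?enum_uniq // => /eqP jj.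
    by congr (Some (_, _)); apply: val_inj.
  - by move=> E; have := fM i j; rewrite E /= (negbTE (Mv i)).
  - by move=> E; have := fM i' j'; rewrite -E /= (negbTE (Mv i')).
move=> _ /imsetP[i _ ->]; rewrite /star_edge imsetU1 /=.
suff -> : (f @: [set Some (i, j) | j : 'I_s])%SET = M i by case: (mem_link_edges (MF i)).
apply/setP => w; apply/imsetP/idP => [[_ /imsetP[j _ ->] ->]//|wM].
have wi : (index w (enum (M i)) < s)%N by rewrite -[X in (_ < X)%N](Ms i) index_mem mem_enum.
exists (Some (i, Ordinal wi)); first by apply/imsetP; exists (Ordinal wi).
by rewrite /f /= nth_index // mem_enum.
Qed.

(** * Complete graphs, missing edges and pair covering *)

Lemma elsym_le_expr (R : realFieldType) (V : finType) (x : V -> R) :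
  (forall v, 0 <= x v) -> forall k (X : {set V}), elsym x k X <= (\sum_(v in X) x v) ^+ k.
Proof.
move=> x0 k X; elim/finset_elim: X k => [|v X vX IH] [|k]; rewrite ?elsym0 ?expr0 //.
  by rewrite elsym_gt_card ?cards0 // big_set0 exprn_ge0.
rewrite elsymU1 // big_setU1 //=; set S := \sum_(i in X) x i.
have S0 : 0 <= S by apply: sumr_ge0.
apply: le_trans (lerD (IH k.+1) (ler_wpM2l (x0 v) (IH k))) _.
rewrite exprS -mulrDl [S + x v]addrC [leRHS]exprS ler_wpM2l ?addr_ge0 //.
by rewrite lerXn2r ?nnegrE ?addr_ge0 // lerDr.
Qed.

Lemma elsymT_complete (R : realType) (r p : nat) (x : 'I_p -> R) :
  lagrange_poly (complete_ugraph r p) x = elsym x r setT.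
Proof. by apply: eq_bigl => e; rewrite !inE subsetT. Qed.

Lemma lagrangian_complete (R : realType) (r p : nat) : (0 < p)%N ->
  lagrangian R (complete_ugraph r p) = 'C(p, r)%:R / p%:R ^+ r.
Proof.
move=> p0; apply/eqP; rewrite eq_le; apply/andP; split.
  have [|x [x0 x1] ->] := @lagrangian_attained R r _ (complete_ugraph r p).
    by rewrite card_ord.
  rewrite elsymT_complete.
  have := @maclaurin R _ x x0 r p [set: 'I_p]%SET; rewrite cardsT card_ord => /(_ (leqnn _)).
  rewrite (eq_bigl predT) ?x1; last by move=> i; rewrite inE.
  by rewrite expr_div_n expr1n mul1r.
have pn0 : p%:R != 0 :> R by rewrite pnatr_eq0 -lt0n.
pose x (_ : 'I_p) : R := p%:R^-1.
have xS : simplex R _ x.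
  by split=> [i|]; rewrite ?invr_ge0 // sumr_const card_ord -[_ *+ _]mulr_natl divff.
apply: le_trans (lagrangian_ge _ xS); rewrite /lagrange_poly /=.
rewrite (eq_bigr (fun=> p%:R^-1 ^+ r)); last first.
  by move=> e; rewrite inE => /eqP er; rewrite prodr_const er.
rewrite sumr_const /complete_edges card_draws card_ord -[leRHS]mulr_natl.
by rewrite exprVn.
Qed.

(** Of the sum over all 4-sets, the missing edge takes away at least c^4. The 4-sets inside T are
    bounded by Maclaurin. The others split into four classes by the size of their trace on T, each
    of weight at most the mass outside T. *)
Lemma missing_edge_bound (R : realType) (V : finType) (G : ugraph 4 V) (x : V -> R)
    (T e0 : {set V}) (m : nat) (c : R) :
  simplex R V x -> (#|T| <= m)%N -> e0 \subset T -> #|e0| = 4%N -> e0 \notin edges G ->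
  0 <= c -> (forall i, i \in T -> c <= x i) ->
  lagrange_poly G x <= 'C(m, 4)%:R / m%:R ^+ 4 - c ^+ 4 + 4 * \sum_(i in ~: T) x i.
Proof.
move=> [x0 x1] Tm e0T e04 e0G c0 cx; set z := \sum_(i in ~: T) x i.
have z0 : 0 <= z by apply: sumr_ge0.
have ST : \sum_(i in T) x i + z = 1.
  rewrite -[RHS]x1 [RHS](bigID (fun i => i \in T)) /=; congr (_ + _).
  by apply: eq_bigl => i; rewrite inE.
have le1 : lagrange_poly G x <= elsym x 4 [set: V]%SET - \prod_(i in e0) x i.
  rewrite /elsym (bigD1 e0) /=; last by rewrite subsetT e04.
  rewrite addrAC subrr add0r /lagrange_poly big_mkcond [leRHS]big_mkcond /=.
  apply: ler_sum => e _; case: ifP => [eG|_].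
    rewrite subsetT (edge_card eG) eqxx /=; case: eqP => //= ee0.
    by rewrite -ee0 eG in e0G.
  by case: ifP => // _; apply: prodr_ge0.
have le2 : c ^+ 4 <= \prod_(i in e0) x i.
  rewrite -e04 -prodr_const; apply: ler_prod => i ie.
  by rewrite c0 cx //; apply: (subsetP e0T).
have dT : [disjoint T & ~: T]%SET by rewrite -setI_eq0 setICr.
have S0 : 0 <= \sum_(i in T) x i by apply: sumr_ge0.
have T4 : elsym x 4 T <= 'C(m, 4)%:R / m%:R ^+ 4.
  apply: le_trans (maclaurin x0 4 Tm) _; rewrite expr_div_n ler_wpM2l //.
  rewrite ler_pdivrMr; last first.
    rewrite exprn_gt0 // ltr0n; apply: leq_trans Tm.
    by rewrite (leq_trans _ (subset_leq_card e0T)) ?e04.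
  rewrite mulVf; first by rewrite exprn_ile1 //; lra.
  rewrite expf_neq0 // pnatr_eq0 -lt0n; apply: leq_trans Tm.
  by rewrite (leq_trans _ (subset_leq_card e0T)) ?e04.
have iT k : 0 <= elsym x k T <= 1.
  rewrite elsym_ge0 //=; apply: le_trans (elsym_le_expr x0 _ _) _.
  by rewrite exprn_ile1 //; lra.
have iZ k : 0 <= elsym x k.+1 (~: T)%SET <= z.
  rewrite elsym_ge0 //=; apply: le_trans (elsym_le_expr x0 _ _) _.
  rewrite -/z exprS ler_piMr // exprn_ile1 //; lra.
have P i j : elsym x i T * elsym x j.+1 (~: T)%SET <= z.
  have /andP[a0 a1] := iT i; have /andP[b0 b1] := iZ j.
  by rewrite -[z]mul1r ler_pM.
apply: le_trans le1 _.
rewrite -(setUCr T) elsym_Vandermonde // !big_ord_recl big_ord0 /bump /=.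
have := (P 0 3, P 1 1, P 2 1, P 3 0, P 1 2)%N => -[[[[P0 P1] P2] P3] P4].
rewrite ?addn0 ?subSS ?subn0 !elsym0 ?mul1r ?mulr1 in P0 P1 P2 P3 P4 *.
lra.
Qed.

(** Besides v, the edge e has at most two vertices in T, because w lies outside. So at least 3t - 3
    vertices of T avoid e; they give t - 1 disjoint triples in the link of v, and e without v is one
    more member. *)
Lemma link_matching_clique (V : finType) (t : nat) (G : ugraph 4 V) (T : {set V}) (w v : V) (e : {set V}) :
  #|T| = (3 * t)%N -> (forall f : {set V}, f \subset T -> #|f| = 4%N -> f \in edges G) ->
  v \in T -> w \notin T -> e \in edges G -> v \in e -> w \in e ->
  has_matching t (link_edges G v).
Proof.
move=> cT Tcl vT wT eG ve we.
pose X := (T :\ v :\: e)%SET.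
have cX : (3 * t.-1 <= #|X|)%N.
  have c1 := cardsD1 v T; rewrite vT cT in c1.
  have c2 := cardsID e (T :\ v)%SET.
  have sub : ((T :\ v) :&: e \subset e :\ v :\ w)%SET.
    apply/subsetP => i; rewrite !inE => /andP[/andP[iv iT] ie]; rewrite iv ie !andbT.
    by apply: contraNneq wT => <-.
  have c3 := subset_leq_card sub.
  have c4 := cardsD1 v e; rewrite ve (edge_card eG) in c4.
  have c5 := cardsD1 w (e :\ v)%SET.
  have wv : w != v by apply: contraNneq wT => ->.
  rewrite !inE wv we /= in c5; rewrite /X; lia.
pose s := enum X.
have sX : size s = #|X| by rewrite -cardE.
have us : uniq s by rewrite enum_uniq.
pose g i := nth v s i.
have gX i : (i < 3 * t.-1)%N -> g i \in X.
  by move=> it; rewrite -mem_enum mem_nth // sX; exact: leq_trans it cX.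
have g_eq i j : (i < 3 * t.-1)%N -> (j < 3 * t.-1)%N -> (g i == g j) = (i == j).
  by move=> it jt; rewrite nth_uniq // sX; apply: leq_trans cX.
(* Index 0 is the member coming from e; the later indices take consecutive triples of the
   enumeration of X. *)
pose M (i : 'I_t) : {set V} := if val i is i'.+1
  then [set g (3 * i')%N; g (3 * i').+1; g (3 * i').+2]%SET else (e :\ v)%SET.
have MX (i : 'I_t) i' : val i = i'.+1 -> M i \subset X.
  move=> Ei; have it := ltn_ord i; have Ei' : nat_of_ord i = i'.+1 by [].
  by rewrite /M Ei !subUset !sub1set !gX //; lia.
exists M; split=> [i|i j ij].
  case Ei: (val i) => [|i'].
    rewrite /M Ei; apply: link_edges_mem; first by rewrite !inE eqxx.
    by rewrite setD1K.
  have MiX := MX _ _ Ei.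
  have vM : v \notin M i.
    by apply/negP => /(subsetP MiX); rewrite !inE eqxx /= andbF.
  have it := ltn_ord i; have {}Ei' : nat_of_ord i = i'.+1 by [].
  apply: link_edges_mem => //; apply: Tcl.
    rewrite subUset sub1set vT /=; apply: subset_trans MiX _.
    by apply/subsetP => u; rewrite !inE => /and3P[].
  rewrite cardsU1 vM /M Ei -setUA !cardsU1 cards1 !inE !g_eq //; lia.
wlog : i j ij / (i < j)%N => [H|lt_ij].
  have [lt_ij|] := ltnP i j; first exact: H.
  rewrite leq_eqVlt => /orP[/eqP E|lt_ji]; last by rewrite disjoint_sym H // eq_sym.
  by case/eqP: ij; apply: val_inj.
have it := ltn_ord i; have jt := ltn_ord j.
case Ej: (val j) => [|j']; first by move: lt_ij; rewrite [nat_of_ord j]Ej.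
have Ej' : nat_of_ord j = j'.+1 by [].
case Ei: (val i) => [|i'].
  rewrite {1}/M Ei disjoint_sym; apply: disjointWl (MX _ _ Ej) _.
  rewrite -setI_eq0; apply/eqP/setP => u; rewrite !inE.
  by case: (u \in e); rewrite ?andbF.
have Ei' : nat_of_ord i = i'.+1 by [].
rewrite /M Ei Ej -setI_eq0; apply/eqP/setP => u; rewrite !inE -orbA.
by apply/negP => /andP[/or3P[] /eqP ->]; rewrite !g_eq //; lia.
Qed.

Lemma clique_isomorphic (V : finType) (r p : nat) (G : ugraph r V) :
  #|V| = p -> (forall f : {set V}, #|f| = r -> f \in edges G) ->
  isomorphic G (complete_ugraph r p).
Proof.
move=> Vp Gcl; exists (fun v => cast_ord Vp (enum_rank v)).
  exists (fun i => enum_val (cast_ord (esym Vp) i)) => [v|i].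
    by rewrite cast_ordK enum_rankK.
  by rewrite enum_valK cast_ordKV.
move=> e; rewrite inE card_imset; last first.
  by move=> u v /cast_ord_inj/enum_rank_inj.
by apply/eqP/idP => [/Gcl//|/edge_card].
Qed.

Lemma covers_clique_isomorphic (V : finType) (t : nat) (G : ugraph 4 V) (T : {set V}) :
  (0 < t)%N -> covers_pairs G -> ~ contains G (linear_star 3 t) -> #|T| = (3 * t)%N ->
  (forall f : {set V}, f \subset T -> #|f| = 4%N -> f \in edges G) ->
  isomorphic G (complete_ugraph 4 (3 * t)).
Proof.
move=> t0 Gcov Gfree cT Tcl.
have TV : T = setT.
  apply/setP => w; rewrite inE; apply/negPn/negP => wT.
  have /card_gt0P[v vT] : (0 < #|T|)%N by rewrite cT; lia.
  have vw : v != w by apply: contraNneq wT => <-.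
  have [e eG /andP[ve we]] := Gcov _ _ vw.
  by apply: Gfree; apply: link_matching_star; exact: (link_matching_clique cT Tcl vT wT eG ve we).
apply: clique_isomorphic; first by rewrite -cT TV cardsT.
by move=> f f4; apply: Tcl => //; rewrite TV subsetT.
Qed.

(** * Stability near equality *)

(** Here l is the Lagrangian of G, k is four times that of the clique, d = x_v - a, q is a^2 times
    the spread of the block averages, and z is the outside mass. As (1 - d)^3 <= 1 - d, the losses
    kd and (t - 1)/40 times the bracket together stay below 4g, and 160g = ky^3/36 turns this into
    the three bounds. *)
Lemma near_extremal_defects (R : realFieldType) (t k y g l d q z : R) :
  2 <= t -> 0 < k <= 1 -> 0 < y <= 1 -> 36 * (16 * (10 * g)) = k * y ^+ 3 ->
  0 <= d <= 1 -> 0 <= q -> 0 <= z ->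
  4 * l + (t - 1) / 40 * (q + (z / t) ^+ 3) <= k * (1 - d) ^+ 3 ->
  k - 4 * g < 4 * l ->
  [/\ d <= y, z <= t * y & 36 * q <= y ^+ 3].
Proof.
move=> t2 /andP[k0 k1] /andP[y0 y1] gE /andP[d0 d1] q0 z0 H1 H2.
have t0 : 0 < t by lra.
have y3 : 0 < y ^+ 3 by rewrite exprn_gt0.
have ky : k * y ^+ 3 <= y ^+ 3 by rewrite ler_piMl // ltW.
have y3_le : y ^+ 3 <= y by rewrite exprS ler_piMr ?exprn_ile1 // ltW.
have cube : (1 - d) ^+ 3 <= 1 - d.
  by rewrite exprS ler_piMr ?exprn_ile1 ?subr_ge0 // lerBlDr lerDl.
have {}H1 := le_trans H1 (ler_wpM2l (ltW k0) cube).
pose z3 := (z / t) ^+ 3; rewrite -/z3 in H1.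
have z30 : 0 <= z3 by rewrite exprn_ge0 // divr_ge0 // ltW.
have qz : q + z3 <= (t - 1) * (q + z3) by rewrite ler_peMl ?addr_ge0 //; lra.
have kd0 : 0 <= k * d by rewrite mulr_ge0 // ltW.
have qz_le : q + z3 <= 16 * (10 * g) by lra.
split; last by lra.
- rewrite -(ler_pM2l k0).
  have := ler_wpM2l (ltW k0) y3_le; lra.
- rewrite leNgt; apply/negP => ez.
  have yz : y < z / t by rewrite ltr_pdivlMr // mulrC.
  have : y ^+ 3 < z3 by rewrite ltrXn2r ?nnegrE // ?ltW // (lt_trans y0).
  by lra.
Qed.

(** Now q is the spread itself. The mass equation forces 6ta >= 1, so the bound on a^2 q becomes a
    bound on q. By the same equation the right side equals 1 - z - (3t - 1)(a + d), what is left in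
    T after 3t - 1 vertices of maximal weight. *)
Lemma top_weight_ge (R : realFieldType) (t y a d q z : R) :
  2 <= t -> 0 < y <= 1 -> 28 * (t ^+ 4 * y) <= 1 -> 0 <= d -> 0 <= q ->
  d <= y -> z <= t * y -> 36 * (a ^+ 2 * q) <= y ^+ 3 ->
  3 * (t * a) - t * q + d + z = 1 ->
  (6 * t)^-1 <= a - t * q - (3 * t - 2) * d.
Proof.
move=> t2 /andP[y0 y1] ty d0 q0 dy zy qy sum1.
have t0 : 0 < t by lra.
have t1 : 1 <= t by lra.
have le_ty k : (k <= 4)%N -> t ^+ k * y <= t ^+ 4 * y.
  by move=> k4; rewrite ler_pM2r // ler_weXn2l.
have ty0 := le_ty 0%N isT; have ty1 := le_ty 1%N isT; have ty2 := le_ty 2%N isT.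
rewrite expr0 mul1r in ty0; rewrite expr1 in ty1.
have tq0 : 0 <= t * q by rewrite mulr_ge0 // ltW.
have a6 : 1 <= 6 * (t * a) by lra.
have t2d : t ^+ 2 * d <= t ^+ 2 * y by rewrite ler_wpM2l ?sqr_ge0.
have td0 : 0 <= t * d by rewrite mulr_ge0 // ltW.
have tq : t ^+ 2 * q <= t ^+ 4 * y.
  have : 1 <= (6 * (t * a)) ^+ 2 by rewrite exprn_ege1.
  move/(ler_wpM2r (mulr_ge0 (sqr_ge0 t) q0)); rewrite mul1r => /le_trans; apply.
  rewrite (_ : _ * (t ^+ 2 * q) = t ^+ 4 * (36 * (a ^+ 2 * q))); last by ring.
  rewrite ler_wpM2l ?exprn_ge0 ?(ltW t0) // (le_trans qy) //.
  by rewrite exprS ler_piMr ?exprn_ile1 // ltW.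
rewrite -(ler_pM2l (_ : 0 < 6 * t)) ?mulr_gt0 // mulfV ?mulf_neq0 ?gt_eqF //.
by lra.
Qed.

(** The link bound at a heaviest vertex v, with T consisting of v and W. Since the masses sum to 1,
    the base of the cube t(a + b + c) + z equals 1 - (x_v - a). *)
Lemma lagrange_poly_star_free (R : realType) (t : nat) (V : finType) (G : ugraph 4 V)
    (x : V -> R) : (2 <= t)%N -> ~ contains G (linear_star 3 t) ->
  simplex R V x -> (forall y, simplex R V y -> lagrange_poly G y <= lagrange_poly G x) ->
  exists (v : V) (T : {set V}) (a b c : R), let z := \sum_(i in ~: T) x i in
  [/\ forall i, x i <= x v, (#|T| <= 3 * t)%N,
      [/\ 0 <= c <= a, 0 <= b <= a & a <= x v],
      x v + ((t%:R - 1) * a + t%:R * b + t%:R * c) + z = 1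
    & 4 * lagrange_poly G x
        + (t%:R - 1) / 40 * (a ^+ 2 * (a - b + (a - c)) + (z / t%:R) ^+ 3)
      <= (t%:R - 1) * (3 * t%:R - 1) * (3 * t%:R - 2) / (54 * t%:R ^+ 3)
         * (1 - (x v - a)) ^+ 3].
Proof.
move=> t2 Gfree xS xmax; have [x0 x1] := xS.
have [v0 v0P] : exists v0 : V, 0 < x v0.
  apply/existsP; rewrite -[[exists _, _]]negbK negb_exists; apply/negP => /forallP H.
  have : \sum_i x i = 0.
    by apply: big1 => i _; apply/eqP; rewrite eq_le x0 andbT leNgt H.
  by rewrite x1 => /eqP; rewrite oner_eq0.
have [v _ vmax] := @Order.TotalTheory.arg_maxP _ _ _ v0 predT x isT.
have {}vmax i : x i <= x v by exact: vmax.
have xv : 0 < x v by exact: lt_le_trans v0P (vmax _).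
pose x' i : R := if i == v then 0 else x i.
have x'0 i : 0 <= x' i by rewrite /x'; case: ifP.
have x'm i : x' i <= x v by rewrite /x'; case: ifP => // _; rewrite ltW.
have F3 e : e \in link_edges G v -> #|e| = 3%N by move/card_link_edges => -[].
have FM : ~ has_matching t (link_edges G v) by move/link_matching_star.
have [W [a [b [c [cW abc SW]]]]] := matching_free_weight_le x'0 t2 (ltW xv) x'm F3 FM.
cbv zeta; set z' := \sum_(i in ~: W) x' i => H.
have Ez : \sum_(i in ~: (v |: W)) x i = z'.
  rewrite /z' [RHS](bigID (fun i => i == v)) /= [X in _ = X + _]big1; last first.
    by move=> i /andP[_ /eqP->]; rewrite /x' eqxx.
  rewrite add0r; apply: eq_big => [i|i].
    by rewrite !inE negb_or andbC.
  by rewrite !inE negb_or /x' => /andP[/negbTE-> _].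
have E1 : x v + (\sum_(i in W) x' i + z') = 1.
  have -> : \sum_(i in W) x' i + z' = \sum_i x' i.
    rewrite [RHS](bigID (fun i => i \in W)) /=; congr (_ + _).
    by apply: eq_bigl => i; rewrite inE.
  rewrite -x1 [RHS](bigD1 v) //= [X in _ + X](bigD1 v) //= {1}/x' eqxx add0r.
  by congr (_ + _); apply: eq_bigr => i /negbTE iv; rewrite /x' iv.
exists v, (v |: W)%SET, a, b, c; rewrite Ez; split=> //.
- rewrite cardsU1; apply: leq_trans (_ : 1 + #|W| <= _)%N; first by case: (v \in W).
  by apply: leq_trans (_ : 1 + (3 * t).-1 <= _)%N; [rewrite leq_add2l | lia].
- by rewrite -SW -addrA.
apply: le_trans (le_trans _ H) _.
  rewrite lerD2r weight_link_edges.
  exact: (lagrange_poly_le_link xS xmax xv).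
rewrite le_eqVlt; apply/orP; left; apply/eqP; congr (_ * _ ^+ 3).
by move: E1; rewrite SW; lra.
Qed.

(** * Choice of the constants and conclusion *)

Theorem theorem4p17 (R : realType) (t : nat) (ht : (2 <= t)%N) :
  lagrangian R (complete_ugraph 4 (3 * t)) =
    ((3 * t)%:R - 1) * ((3 * t)%:R - 2) * ((3 * t)%:R - 3) / (24 * (3 * t)%:R ^+ 3)
  /\ exists2 c3 : R, 0 < c3 &
     forall (V : finType) (G : ugraph 4 V), ~ contains G (linear_star 3 t) ->
       lagrangian R G <= lagrangian R (complete_ugraph 4 (3 * t))
       /\ (covers_pairs G -> ~ isomorphic G (complete_ugraph 4 (3 * t)) ->
           lagrangian R G <= lagrangian R (complete_ugraph 4 (3 * t)) - c3).
Proof.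
have t0 : (0 < 3 * t)%N by lia.
have T2 : 2 <= t%:R :> R by rewrite (ler_nat R 2).
have Tn0 : t%:R != 0 :> R by apply/eqP; lra.
have T0 : 0 < t%:R :> R by lra.
have lamE := lagrangian_complete R 4 t0; rewrite natr_bin4 in lamE.
split; first by rewrite lamE natrM; field; exact: Tn0.
pose k : R := (t%:R - 1) * (3 * t%:R - 1) * (3 * t%:R - 2) / (54 * t%:R ^+ 3).
have {}lamE : lagrangian R (complete_ugraph 4 (3 * t)) = k / 4.
  by rewrite lamE /k natrM; field; exact: Tn0.
have T30 : 0 < t%:R ^+ 3 :> R by rewrite exprn_gt0.
have k0 : 0 < k by rewrite /k divr_gt0 ?mulr_gt0 //; lra.
have k1 : k <= 1.
  have sq : t%:R <= t%:R ^+ 2 :> R by rewrite expr2 ler_peMl //; lra.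
  by rewrite /k ler_pdivrMr ?mulr_gt0 //; lra.
have iT0 : 0 < (6 * t%:R)^-1 :> R by rewrite invr_gt0; lra.
have iT1 : (6 * t%:R)^-1 <= 1 :> R by rewrite invf_le1; lra.
(* With this tolerance the outside mass z <= ty contributes 4z, at most half of the loss (6t)^-4
   caused by a missing edge. *)
pose y : R := (6 * t%:R)^-1 ^+ 4 / (8 * t%:R).
have ty : 8 * (t%:R * y) = (6 * t%:R)^-1 ^+ 4 by rewrite /y; field; exact: Tn0.
have y0 : 0 < y by rewrite divr_gt0 ?exprn_gt0 ?mulr_gt0.
have y1 : y <= 1.
  have i4 : (6 * t%:R)^-1 ^+ 4 <= 1 :> R by rewrite exprn_ile1 // ltW.
  have := ler_wpM2r (ltW y0) T2; lra.
have yy : 0 < y <= 1 by rewrite y0.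
have t4y : 28 * (t%:R ^+ 4 * y) <= 1.
  rewrite (_ : t%:R ^+ 4 * y = (6 * t%:R)^-1 / 8 / 6 ^+ 3); last first.
    by rewrite /y; field; exact: Tn0.
  by lra.
(* The gap [c3], scaled to fit [near_extremal_defects]. *)
pose g := k * y ^+ 3 / (36 * (16 * 10)).
have gE : 36 * (16 * (10 * g)) = k * y ^+ 3 by rewrite /g; field.
have ky0 : 0 < k * y ^+ 3 by rewrite mulr_gt0 ?exprn_gt0.
have g0 : 0 < g by lra.
have y3 : y ^+ 3 <= y by rewrite exprS ler_piMr ?exprn_ile1 // ltW.
have g_y : g <= y.
  have : k * y ^+ 3 <= y ^+ 3 by rewrite ler_piMl // exprn_ge0 // ltW.
  by lra.
have g_k : g <= k / 4.
  have : k * y ^+ 3 <= k by rewrite ler_piMr ?(le_trans y3) // ltW.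
  by lra.
rewrite lamE; exists g => // V G Gfree.
have [V0|Vpos] := posnP #|V|.
  (* On an empty vertex set the simplex is empty, and its supremum is 0 by convention. *)
  have -> : lagrangian R G = 0.
    rewrite /lagrangian [X in sup X](_ : _ = classical_sets.set0) ?sup0 //.
    apply/seteqP; split=> // u [w [_ w1] _].
    move: w1; rewrite big_pred0 => [/eqP|i]; first by rewrite eq_sym oner_eq0.
    by have := card0_eq V0 i; rewrite inE.
  by split; lra.
have [x xS lamx] := lagrangian_attained R G Vpos.
have xmax w : simplex R V w -> lagrange_poly G w <= lagrange_poly G x.
  by move=> wS; rewrite -lamx lagrangian_ge.
have [v [T [a [b [c]]]]] := lagrange_poly_star_free ht Gfree xS xmax.
cbv zeta; set z := \sum_(i in ~: T) x i => -[vmax cT [ca ba am] sum1]; rewrite -/k => H.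
have [x0 x1] := xS.
have z0 : 0 <= z by apply: sumr_ge0.
rewrite lamx; split.
  have tail0 : 0 <= (t%:R - 1) / 40 * (a ^+ 2 * (a - b + (a - c)) + (z / t%:R) ^+ 3).
    apply: mulr_ge0; first by lra.
    apply: addr_ge0; first by rewrite mulr_ge0 ?sqr_ge0 //; lra.
    by rewrite exprn_ge0 // divr_ge0.
  have : (1 - (x v - a)) ^+ 3 <= 1.
    have xv1 := simplex_le1 xS v.
    by rewrite exprn_ile1 //; lra.
  move/(ler_wpM2l (ltW k0)); lra.
move=> Gcov Giso; rewrite leNgt; apply/negP => Hgap.
have H2 : k - 4 * g < 4 * lagrange_poly G x by lra.
have kk : 0 < k <= 1 by rewrite k0.
have xv1 := simplex_le1 xS v.
have q0 : 0 <= a - b + (a - c) by lra.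
have d0 : 0 <= x v - a by lra.
have d1 : 0 <= x v - a <= 1 by lra.
have [d_y z_y aq_y] :=
  near_extremal_defects T2 kk yy gE d1 (mulr_ge0 (sqr_ge0 a) q0) z0 H H2.
have sum1' : 3 * (t%:R * a) - t%:R * (a - b + (a - c)) + (x v - a) + z = 1 by lra.
have top : (6 * t%:R)^-1 <= 1 - z - (3 * t%:R - 1) * x v.
  have := top_weight_ge T2 yy t4y d0 q0 d_y z_y aq_y sum1'; lra.
have sumT : \sum_(i in T) x i = 1 - z.
  have -> : z = \sum_(i | i \notin T) x i by apply: eq_bigl => i; rewrite inE.
  by rewrite -x1 [X in X - _](bigID (fun i => i \in T)) /= addrK.
have m3 : (3 * t)%:R = 3 * t%:R :> R by rewrite natrM.
(* The other vertices of T, at most 3t - 1 in number, weigh at most [x v] each; [top] bounds what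
   remains for i. *)
have xT i : i \in T -> (6 * t%:R)^-1 <= x i.
  move=> iT'; apply: le_trans top _.
  rewrite -sumT (bigD1 i) //= lerBlDr lerD2l.
  have -> : \sum_(j in T | j != i) x j = \sum_(j in (T :\ i)%SET) x j.
    by apply: eq_bigl => j; rewrite !inE andbC.
  rewrite -m3 -[(3 * t)%:R - 1](_ : (3 * t).-1%:R = _); last first.
    by rewrite -{2}(prednK t0) -natr1 addrK.
  apply: sum_le_card => //.
  by rewrite -ltnS (prednK t0); move: cT; rewrite (cardsD1 i) iT'.
(* With fewer vertices T would have mass at most (3t - 1) times [x v], against [top]. *)
have cT3 : #|T| = (3 * t)%N.
  apply/eqP; rewrite eqn_leq cT /= leqNgt; apply/negP => T_lt.
  have cT1 : (#|T| <= (3 * t).-1)%N by rewrite -ltnS (prednK t0).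
  have := sum_le_card (x0 v) cT1 (fun i _ => vmax i); rewrite sumT.
  have -> : (3 * t).-1%:R = 3 * t%:R - 1 :> R.
    by rewrite -m3 -{2}(prednK t0) -natr1 addrK.
  by lra.
apply: Giso; apply: (covers_clique_isomorphic _ Gcov Gfree cT3); first exact: ltnW.
(* A missing 4-subset of T would lower the Lagrangian by at least 8ty - 4ty = 4ty, which exceeds
   g. *)
move=> f fT f4; apply/negPn/negP => fG.
have := missing_edge_bound xS cT fT f4 fG (ltW iT0) xT.
rewrite natr_bin4 m3 -/z (_ : _ / _ = k / 4); last by rewrite /k; field; exact: Tn0.
have := ler_wpM2r (ltW y0) T2; lra.
Qed.
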